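(* Let $G$ be any connected graph. If $T_{\mathrm{NT}} \subseteq G$ is a normal tree such that every component of $G - T_{\mathrm{NT}}$ has finite neighbourhood, then $G$ has a rooted tree-decomposition $(T, \mathcal{V})$ with the following three properties: - its separators are upwards disjoint, finite and connected; - $(T, \mathcal{V})$ displays the undominated ends of $G$ that lie in the closure of $V(T_{\mathrm{NT}})$; - $(T, \mathcal{V})$ covers $V(T_{\mathrm{NT}})$ cofinally.
   Context: Graphs may be infinite. A rooted tree $T_{\mathrm{NT}}\subseteq G$ is normal in $G$ if the endvertices of every $T_{\mathrm{NT}}$-path in $G$ are comparable in its tree-order. The neighbourhood of a component $C$ of $G-T_{\mathrm{NT}}$ is the set of vertices outside $C$ adjacent to $C$. A comb is the union of a ray $R$ (its spine) with infinitely many disjoint finite paths, possibly trivial, having precisely their first vertex on $R$; their last vertices are the teeth; a comb attached to $W$ has all teeth in $W$. An end of $G$ is an equivalence class of rays, two rays being equivalent if no finite vertex set separates them; an end $\omega$ lies in the closure of a vertex set $W$ if $G$ contains a comb attached to $W$ with spine in $\omega$. A vertex $v$ dominates a ray $R$ if there are infinitely many $v$–$(R-v)$ paths pairwise meeting only in $v$; an end is undominated if its rays are dominated by no vertex. For a tree-decomposition $(T,(V_t)_{t\in T})$ the separator associated with an edge $t_1t_2$ is $V_{t_1}\cap V_{t_2}$, connected if it induces a connected subgraph. In a rooted tree-decomposition (root $r$, tree-order on $T$) the separators are upwards disjoint if any two distinct edges $e,f$ with $e$ on the path from $r$ to $f$ have disjoint separators. If all separators are finite, each end $\omega$ of $G$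 orients each edge $t_1t_2$ of $T$ towards that component of $T-t_1t_2$ whose parts (minus the separator) contain tails of the rays of $\omega$; either all edges point to a unique node ($\omega$ lives there) or to a unique end $\eta$ of $T$ ($\omega$ corresponds to $\eta$); write $\tau(\omega)$ for this node or end. The decomposition displays a set $\Psi$ of ends if $\tau$ restricts to a bijection from $\Psi$ onto the set of ends of $T$ and maps every end not in $\Psi$ to a node of $T$. A rooted tree-decomposition covers a vertex set $W$ cofinally if every node of $T$ lies below (in the tree-order) some node whose part meets $W$. *)

(* Defs.v *)
From mathcomp Require Import all_boot.
From mathcomp Require Import all_classical.

Set Implicit Arguments.
Unset Strict Implicit.
Unset Printing Implicit Defensive.

Local Open Scope classical_set_scope.

(** Simple graphs, possibly infinite, whose vertices form a subset of an
    ambient type; subgraphs of [G : graph V] are again of type [graph V].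
    Since MathComp-Analysis works with classical choice, asking for a
    [choiceType] instead of a [Type] is no restriction, and a boolean adjacency
    relation is as general as one in [Prop]. *)
Record graph (V : choiceType) := Graph {
  verts : set V;
  adj : rel V;
  adj_sym : symmetric adj;
  adj_irr : irreflexive adj;
  adj_verts : forall x y, adj x y -> verts x
}.

Section Graphs.
Variable V : choiceType.
Implicit Types (G H T : graph V) (x y : V) (p : seq V) (A B W X : set V).
Implicit Types (R Q : nat -> V) (w : set (nat -> V)).

Definition subgraph H G := verts H `<=` verts G /\ subrel (adj H) (adj G).

Section Induced.
Variables (G : graph V) (U : set V).
Let iadj : rel V := fun x y => [&& adj G x y, x \in U & y \in U].
Let iadj_sym : symmetric iadj.
Proof. by move=> x y; rewrite /iadj adj_sym (andbC (x \in U)). Qed.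
Let iadj_irr : irreflexive iadj.
Proof. by move=> x; rewrite /iadj adj_irr. Qed.
Let iadj_verts x y : iadj x y -> (verts G `&` U) x.
Proof. by case/and3P=> /adj_verts Gx /set_mem Ux _. Qed.
Definition induced : graph V := Graph iadj_sym iadj_irr iadj_verts.
End Induced.

Section DelEdge.
Variables (G : graph V) (a b : V).
Let dadj : rel V := fun x y =>
  [&& adj G x y, (x, y) != (a, b) & (x, y) != (b, a)].
Let dadj_sym : symmetric dadj.
Proof.
move=> x y; rewrite /dadj adj_sym !xpair_eqE (andbC (x == a)) (andbC (x == b)).
by rewrite (andbC (~~ ((y == b) && _))).
Qed.
Let dadj_irr : irreflexive dadj.
Proof. by move=> x; rewrite /dadj adj_irr. Qed.
Let dadj_verts x y : dadj x y -> verts G x.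
Proof. by case/and3P=> /adj_verts. Qed.
Definition del_edge : graph V := Graph dadj_sym dadj_irr dadj_verts.
End DelEdge.

(** [gpath G x p]: the sequence [x :: p] is a (possibly trivial) finite path in
    [G], from [x] to [last x p]. *)
Definition gpath G x p :=
  [/\ verts G x, path (adj G) x p & uniq (x :: p)].

(** Consecutive pairs of vertices of [x :: p]. *)
Definition path_edges x p : seq (V * V) := zip (x :: p) p.

(** An A--B path: precisely its first vertex lies in A and precisely its last
    one lies in B. *)
Definition AB_path G A B x p :=
  [/\ gpath G x p,
      forall z, z \in x :: p -> (A z <-> z = x) &
      forall z, z \in x :: p -> (B z <-> z = last x p)].

(** An H-path in G: non-trivial and meeting H exactly in its ends, so that it
    also has no edge in H. *)
Definition H_path G H x p :=
  [/\ gpath G x p, p <> [::],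
      forall z, z \in x :: p -> (verts H z <-> z = x \/ z = last x p) &
      forall e, e \in path_edges x p -> ~~ adj H e.1 e.2].

(** As usual, the empty graph is not connected. *)
Definition connected G :=
  verts G !=set0 /\
  forall x y, verts G x -> verts G y -> exists2 p, gpath G x p & last x p = y.

(** The (vertex set of the) component of G containing the vertex x. *)
Definition component G x : set V :=
  [set y | exists2 p, gpath G x p & last x p = y].

Definition neighbourhood G A : set V :=
  [set v | verts G v /\ ~ A v /\ exists2 u, A u & adj G u v].

Definition acyclic G := forall c : seq V, ucycle (adj G) c -> size c <= 2.

Definition tree T := connected T /\ acyclic T.

Definition rooted_tree T (r : V) := tree T /\ verts T r.

(** The tree-order of (T, r): x lies on the path in T from r to y. *)
Definition tree_le T (r : V) x y :=
  exists p, [/\ gpath T r p, last r p = y & x \in r :: p].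

Definition normal_tree G H (r : V) :=
  [/\ subgraph H G, rooted_tree H r &
      forall x p, H_path G H x p ->
        tree_le H r x (last x p) \/ tree_le H r (last x p) x].

Definition ray G R := injective R /\ forall n, adj G (R n) (R n.+1).

Definition has_tail_in R A := exists n0, forall n, n0 <= n -> A (R n).

Definition separates G X A B :=
  forall x p, AB_path G A B x p -> exists2 z, z \in x :: p & X z.

Definition ray_equiv G R Q :=
  forall X, finite_set X -> ~ separates G X (range R) (range Q).

(** Ends are equivalence classes of rays. *)
Definition is_end G w :=
  exists2 R, ray G R & w = [set Q | ray G Q /\ ray_equiv G R Q].

(** There is a comb in G with spine R attached to W; its paths are the
    [x n :: p n]. *)
Definition has_comb G R W :=
  ray G R /\
  exists (x : nat -> V) (p : nat -> seq V),
    [/\ forall n, gpath G (x n) (p n),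
        forall n z, z \in x n :: p n -> (range R z <-> z = x n),
        forall m n z, z \in x m :: p m -> z \in x n :: p n -> m = n &
        forall n, W (last (x n) (p n))].

Definition in_closure G W w := exists2 R, w R & has_comb G R W.

Definition dominates G v R :=
  exists p : nat -> seq V,
    (forall n, AB_path G [set v] (range R `\ v) v (p n)) /\
    (forall m n z, m <> n -> z \in v :: p m -> z \in v :: p n -> z = v).

Definition undominated G w := forall R, w R -> forall v, ~ dominates G v R.

End Graphs.

Section TreeDecompositions.
Variables (V N : choiceType).
Implicit Types (G : graph V) (T : graph N) (part : N -> set V).
Implicit Types (w : set (nat -> V)) (t : N).

Definition tree_decomposition G T part :=
  [/\ tree T,
      \bigcup_(t in verts T) part t = verts G,
      forall x y, adj G x y -> exists t, [/\ verts T t, part t x & part t y] &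
      forall t1 p t2, gpath T t1 p -> t2 \in t1 :: p ->
        part t1 `&` part (last t1 p) `<=` part t2].

Definition separator part t1 t2 : set V := part t1 `&` part t2.

(** For an edge f = [t1 t2], the path from the root r to f is the path from r
    whose last vertex is its only vertex in f. It does not contain f, so the
    edges [e.1 e.2] on it are distinct from f. *)
Definition upwards_disjoint T (r : N) part :=
  forall t1 t2 p e, adj T t1 t2 ->
    AB_path T [set r] [set t1; t2] r p -> e \in path_edges r p ->
    separator part e.1 e.2 `&` separator part t1 t2 = set0.

(** The component of T - t1t2 containing t2. *)
Definition side T t1 t2 : set N := component (del_edge T t1 t2) t2.

(** The end w of G orients the edge t1t2 of T from t1 to t2. *)
Definition orients T part w t1 t2 :=
  forall R, w R ->
    has_tail_in R
      ((\bigcup_(t in side T t1 t2) part t) `\` separator part t1 t2).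

(** The possible values of tau are nodes of T ([inl]) and ends of T ([inr]). *)
Definition node_or_end T (z : N + set (nat -> N)) :=
  match z with inl t => verts T t | inr eta => is_end T eta end.

(** On which side of an edge t1t2 of T a node or an end of T lies. *)
Definition on_side T t1 t2 (z : N + set (nat -> N)) :=
  match z with
  | inl t => side T t1 t2 t
  | inr eta => forall Q, eta Q -> has_tail_in Q (side T t1 t2)
  end.

(** w lives at z (if z is a node) or corresponds to z (if z is an end): all
    edges of T are oriented by w towards z. *)
Definition points_to T part w (z : N + set (nat -> N)) :=
  node_or_end T z /\
  forall t1 t2, adj T t1 t2 -> (orients T part w t1 t2 <-> on_side T t1 t2 z).

Definition displays G T part (Psi : set (set (nat -> V))) :=
  exists tau : set (nat -> V) -> N + set (nat -> N),
    [/\ forall w, is_end G w -> points_to T part w (tau w),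
        set_bij Psi (inr @` [set eta | is_end T eta]) tau &
        forall w, is_end G w -> ~ Psi w -> exists2 t, verts T t & tau w = inl t].

Definition covers_cofinally T (r : N) part (W : set V) :=
  forall t, verts T t ->
    exists s, [/\ verts T s, tree_le T r t s & part s `&` W !=set0].

End TreeDecompositions.

(* Main.v *)
Require Import Defs.
From mathcomp Require Import all_boot.
From mathcomp Require Import all_classical.

(* Let C(t), for t in the normal tree, be the component containing t of the graph
   left after deleting the vertices strictly below t. Its neighbours form a finite
   chain below t, and the interval S(t) of the normal tree from the least of them to
   the parent of t is a finite connected set separating C(t) from the rest. Going up
   the tree, call t a cut vertex greedily, as soon as S(t) starts at or above the
   last cut vertex below t; then the sets S(t) of comparable cut vertices are
   disjoint. The cut vertices with the induced order form the decomposition tree, and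
   the part of s consists of S(s) and of the vertices in C(s) but in no C(t) for a
   higher cut vertex t.
   An end points up to the cut vertices t for which C(t) contains its tails. If these
   are infinitely many, then the disjoint finite sets S(t) make the end undominated,
   and its rays meet infinitely many of them, so that it lies in the closure of the
   normal tree. Conversely, an end in this closure lies in C(t) for infinitely many
   vertices t of a branch of the normal tree; if only finitely many of these are cut
   vertices, then infinitely many of the nested sets C(t) have a neighbour below the
   last cut vertex, and some such neighbour is common to all of them and dominates the
   end. *)

Set Implicit Arguments.
Unset Strict Implicit.
Unset Printing Implicit Defensive.

Local Open Scope classical_set_scope.

(** * Reachability, crossing edges and A-B paths *)

Section Walks.
Variable V : choiceType.
Implicit Types (G H : graph V) (x y z : V) (p : seq V) (A B U X : set V).

Lemma adj_vertsr G x y : adj G x y -> verts G y.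
Proof. by rewrite adj_sym => /adj_verts. Qed.

Lemma adj_induced G U x y : adj (induced G U) x y <-> [/\ adj G x y, U x & U y].
Proof.
split=> [/and3P[xy /set_mem Ux /set_mem Uy]|[xy Ux Uy]] //.
by apply/and3P; split; rewrite ?inE.
Qed.

(* [component G x y] serves as the reachability relation of [G]. *)
Lemma componentP G x y :
  component G x y <-> verts G x /\ exists2 p, path (adj G) x p & last x p = y.
Proof.
split=> [[p [Gx px _] lp]|[Gx [p px <-]]]; first by split=> //; exists p.
by case/shortenP: px => p' px' u' _; exists p'.
Qed.

Lemma component_refl G x : verts G x -> component G x x.
Proof. by move=> Gx; apply/componentP; split=> //; exists [::]. Qed.

Lemma component_trans G y x z :
  component G x y -> component G y z -> component G x z.
Proof.
move=> /componentP[Gx [p px <-]] /componentP[_ [q qx <-]].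
apply/componentP; split=> //; exists (p ++ q); last by rewrite last_cat.
by rewrite cat_path px.
Qed.

Lemma component_adj G x y : adj G x y -> component G x y.
Proof.
move=> xy; apply/componentP; split; first exact: adj_verts xy.
by exists [:: y] => //=; rewrite xy.
Qed.

Lemma component_ind G x y A :
  A x -> (forall a b, A a -> adj G a b -> A b) -> component G x y -> A y.
Proof.
move=> Ax step /componentP[_ [p px <-]].
elim: p x Ax px => //= a p IH x Ax /andP[xa pa].
exact: IH (step _ _ Ax xa) pa.
Qed.

Lemma component_verts G x y : component G x y -> verts G y.
Proof.
move=> xy; have [Gx _] := (componentP _ _ _).1 xy.
by apply: component_ind xy => // a b _ /adj_vertsr.
Qed.

Lemma component_sym G x y : component G x y -> component G y x.
Proof.
move=> xy; have [Gx _] := (componentP _ _ _).1 xy.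
apply: (@component_ind G x y (fun z => component G z x)) xy.
  exact: component_refl.
move=> a b xa ab; apply: component_trans xa; apply: component_adj.
by rewrite adj_sym.
Qed.

Lemma component_sub G H x y : verts H x ->
  (forall a b, adj G a b -> adj H a b) -> component G x y -> component H x y.
Proof.
move=> Hx GH; apply: component_ind; first exact: component_refl.
by move=> a b xa /GH /component_adj; apply: component_trans.
Qed.

Lemma gpath_verts G x p z : gpath G x p -> z \in x :: p -> verts G z.
Proof.
case=> Gx px _ /splitPl zp; case: zp px => p1 p2 <-; rewrite cat_path.
case/andP=> p1x _; apply: (@component_verts G x).
by apply/componentP; split=> //; exists p1.
Qed.

Lemma path_cross G A x p : path (adj G) x p -> A x -> ~ A (last x p) ->
  exists a b, [/\ adj G a b, A a, ~ A b, a \in x :: p & b \in p].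
Proof.
elim: p x => [//|y p IH] x /= /andP[xy py] Ax nA.
case: (pselect (A y)) => Ay; last first.
  by exists x, y; rewrite !mem_head.
have [a [b [ab Aa nb ap bp]]] := IH _ py Ay nA.
by exists a, b; split=> //; rewrite inE ?ap ?bp orbT.
Qed.

Lemma path_edgesP (e : rel V) x p a b : path e x p -> (a, b) \in path_edges x p ->
  [/\ e a b, a \in belast x p & b \in p].
Proof.
rewrite /path_edges; elim: p x => [|y p IH] x //= /andP[xy py].
rewrite inE => /orP[/eqP[-> ->]|ab]; first by rewrite !mem_head.
have [eab ax bp] := IH _ py ab.
by split=> //; rewrite inE ?ax ?bp orbT.
Qed.

(** Induction on the length of a path from [a] to [b] inside [U]: if it meets [A] after its first
    vertex or [B] before its last one, a proper subpath takes its place. *)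
Lemma AB_path_in G U A B a b : A a -> B b -> component (induced G U) a b ->
  exists x p, AB_path G A B x p /\ forall z, z \in x :: p -> U z.
Proof.
move=> Aa Bb [p pa lp]; rewrite -{}lp in Bb.
have [n] := ubnP (size p); elim: n => // n IH in a p pa Aa Bb *.
rewrite ltnS => pn.
case: (pselect (exists z, [/\ z \in a :: p, A z & z <> a])) => [[z [zp Az za]]|nA].
  case/splitPl: zp => p1 p2 lp1 in pa Bb pn *.
  case: pa => Ga; rewrite cat_path lp1 -cat_cons cat_uniq.
  case/andP=> p1a p2z /and3P[u1 /hasPn u12 u2].
  apply: (IH z p2) => //.
  - split=> //=; last first.
      rewrite u2 andbT; apply/negP=> /u12; rewrite -lp1.
      by rewrite mem_last.
    rewrite -lp1; apply: (@component_verts (induced G U) a).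
    by apply/componentP; split=> //; exists p1.
  - by move: Bb; rewrite last_cat lp1.
  - apply: leq_trans pn; rewrite size_cat -add1n leq_add2r.
    by case: p1 lp1 {u1 u12 p1a Bb} => // za'; case: za.
case: (pselect (exists z, [/\ z \in a :: p, B z & z <> last a p])) => [[z [zp Bz zl]]|nB].
  case/splitPl: zp => p1 p2 lp1 in pa Bb pn nA zl *.
  case: pa => Ga; rewrite cat_path lp1 -cat_cons cat_uniq.
  case/andP=> p1a p2z /and3P[u1 _ _].
  apply: (IH a p1) => //; first by rewrite lp1.
  apply: leq_trans pn; rewrite size_cat -addn1 leq_add2l.
  by case: p2 zl {p2z Bb nA} => //; rewrite cats0 lp1.
exists a, p; split; last first.
  by move=> z /(gpath_verts pa) [].
case: (pa) => -[Ga _] pp up; split.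
- split=> //; apply: sub_path pp => u v; case/and3P=> //.
- move=> z zp; split=> [Az|->//]; apply: contrapT => za; apply: nA; by exists z.
- move=> z zp; split=> [Bz|->//]; apply: contrapT => za; apply: nB; by exists z.
Qed.

End Walks.

(** * Rays, ends and finite separators; building combs and fans *)

Section Rays.
Variable V : choiceType.
Implicit Types (G : graph V) (C S U X : set V) (R Q : nat -> V).

(** [S] may be larger than the neighbourhood of [C], so that whole intervals of the normal tree
    qualify. *)
Definition boundary_of G C S :=
  finite_set S /\ forall x y, adj G x y -> C x -> ~ C y -> S y.

Lemma ray_verts G R n : ray G R -> verts G (R n).
Proof. by case=> _ /(_ n) /adj_verts. Qed.

Lemma ray_avoids_finite G R X : ray G R -> finite_set X -> has_tail_in R (~` X).
Proof.
case=> injR _ /finite_seqP[s ->] {X}.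
elim: s => [|x s [n0 IH]]; first by exists 0.
case: (pselect (exists n, R n = x)) => [[n Rn]|nR].
  exists (maxn n0 n.+1) => m; rewrite geq_max => /andP[/IH ns mn].
  rewrite /= inE => /orP[/eqP|//]; rewrite -Rn => /injR E.
  by rewrite E ltnn in mn.
exists n0 => m /IH ns; rewrite /= inE => /orP[/eqP Rm|//].
by apply: nR; exists m.
Qed.

Lemma tail_in_cap R C S :
  has_tail_in R C -> has_tail_in R S -> has_tail_in R (C `&` S).
Proof.
move=> [n CR] [m SR]; exists (maxn n m) => k.
by rewrite geq_max => /andP[/CR ? /SR ?].
Qed.

Lemma tail_in_sub R C S : C `<=` S -> has_tail_in R C -> has_tail_in R S.
Proof. by move=> CS [n CR]; exists n => m /CR /CS. Qed.

Lemma tail_in_exists R C : has_tail_in R C -> exists n, C (R n).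
Proof. by case=> n /(_ n (leqnn n)); exists n. Qed.

(** Once the ray has left the finite set [S] for good, it can no longer step out of [C]. *)
Lemma tail_dichotomy G C S R : ray G R -> boundary_of G C S ->
  has_tail_in R C \/ has_tail_in R (~` C `\` S).
Proof.
move=> rR [finS bd]; have [n0 nS] := ray_avoids_finite rR finS.
have stay n : n0 <= n -> C (R n) -> has_tail_in R C.
  move=> n0n Cn; exists n => m; elim: m => [|m IH].
    by rewrite leqn0 => /eqP <-.
  rewrite leq_eqVlt => /orP[/eqP <-//|nm].
  apply: contrapT => nC; apply: (nS m.+1); first by rewrite (leq_trans n0n) // ltnW.
  by apply: bd (rR.2 m) (IH nm) nC.
case: (pselect (has_tail_in R C)) => [|nC]; first by left.
right; exists n0 => n n0n; split; last exact: nS.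
by move=> Cn; apply: nC; apply: stay Cn.
Qed.

(** If [Q] had a tail outside [C], then [S] together with finite initial segments of both rays would
    separate them: a path between the remaining tails leaves [C] and so meets [S]. *)
Lemma ray_equiv_tail G C S R Q : ray G Q -> boundary_of G C S ->
  ray_equiv G R Q -> has_tail_in R C -> has_tail_in Q C.
Proof.
move=> rQ bd RQ [n0 CR].
case: (tail_dichotomy rQ bd) => // -[m0 CQ]; exfalso.
apply: (RQ (S `|` (R @` `I_n0 `|` Q @` `I_m0))).
  by rewrite !finite_setU; split; [case: bd|split; apply: finite_image].
move=> x p [[Gx px ux] /(_ x) Rx /(_ (last x p)) Qx].
have [i _ Ri] := (Rx (mem_head _ _)).2 (erefl _).
have [j _ Qj] := (Qx (mem_last _ _)).2 (erefl _).
case: (ltnP i n0) => [in0|n0i].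
  by exists x; [rewrite mem_head|right; left; exists i].
case: (ltnP j m0) => [jm0|m0j].
  by exists (last x p); [rewrite mem_last|right; right; exists j].
have Cx : C x by rewrite -Ri; apply: CR.
have nCl : ~ C (last x p) by rewrite -Qj; case: (CQ _ m0j).
have [a [b [ab Ca Cb ap bp]]] := path_cross px Cx nCl.
by exists b; [rewrite inE bp orbT|left; apply: bd.2 ab Ca Cb].
Qed.

(** The criterion by which rays are shown equivalent: a connected set that avoids [X] and meets both
    rays contains a path between them. *)
Lemma ray_equiv_of_common G R Q :
  (forall X, finite_set X -> exists U, [/\ has_tail_in R U, has_tail_in Q U,
     U `<=` ~` X & forall x y, U x -> U y -> component (induced G U) x y]) ->
  ray_equiv G R Q.
Proof.
move=> common X /common[U [/tail_in_exists[i Ui] /tail_in_exists[j Uj] UX con]] sep.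
have Ri : range R (R i) by exists i.
have Qj : range Q (Q j) by exists j.
have [x [p [xp Up]]] := AB_path_in Ri Qj (con _ _ Ui Uj).
by have [z /Up /UX] := sep _ _ xp.
Qed.

Lemma ray_equiv_refl G R : ray G R -> ray_equiv G R R.
Proof.
move=> rR X finX sep; have [n nX] := ray_avoids_finite rR finX.
have RRn : AB_path G (range R) (range R) (R n) [::].
  split; first by split=> //; apply: ray_verts rR.
    by move=> z; rewrite inE => /eqP ->; split=> // _; exists n.
  by move=> z; rewrite inE => /eqP ->; split=> // _; exists n.
have [z] := sep _ _ RRn.
by rewrite inE => /eqP -> /nX; apply.
Qed.

Lemma end_ray G w R : is_end G w -> w R -> ray G R.
Proof. by case=> Q _ -> []. Qed.

Lemma end_nonempty G w : is_end G w -> exists R, w R.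
Proof. by case=> Q rQ ->; exists Q; split=> //; apply: ray_equiv_refl. Qed.

(** Equivalence is given only from the representative [R0] to the other rays. If [R0] had no tail in
    [C], it would have one in the complement of [C] and [S], which is also bounded by [S], and this
    would carry over to [R]. *)
Lemma end_tail G C S w R : is_end G w -> boundary_of G C S -> w R ->
  has_tail_in R C -> forall Q, w Q -> has_tail_in Q C.
Proof.
move=> [R0 rR0 wE] bd; rewrite {}wE => -[rR R0R] CR Q [rQ R0Q].
apply: (ray_equiv_tail rQ bd R0Q).
case: (tail_dichotomy rR0 bd) => // CR0; exfalso.
have bd' : boundary_of G (~` C `\` S) S.
  split; first by case: bd.
  move=> x y xy [nCx nSx] nCy; apply: contrapT => nSy; apply: nCy; split=> //.
  by move=> Cy; apply: nSx; apply: (bd.2 y x) => //; rewrite adj_sym.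
have := ray_equiv_tail rR bd' R0R CR0.
by move=> /(tail_in_cap CR)/tail_in_exists[n [? []]].
Qed.

Lemma end_dichotomy G C S w : is_end G w -> boundary_of G C S ->
  (forall R, w R -> has_tail_in R C) \/
  (forall R, w R -> has_tail_in R (~` C `\` S)).
Proof.
move=> ew bd; have [R wR] := end_nonempty ew.
case: (tail_dichotomy (end_ray ew wR) bd) => CR.
  by left; apply: end_tail ew bd wR CR.
right=> Q wQ; case: (tail_dichotomy (end_ray ew wQ) bd) => // CQ; exfalso.
have := end_tail ew bd wQ CQ wR.
by move=> /(tail_in_cap CR)/tail_in_exists[n [[]]].
Qed.

Lemma finite_set_no_injection X (g : nat -> V) :
  finite_set X -> (forall n, X (g n)) -> ~ injective g.
Proof.
move=> /finite_seqP[s Xs] gX ginj.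
have sub : {subset map g (iota 0 (size s).+1) <= s}.
  by move=> _ /mapP[n _ ->]; have := gX n; rewrite Xs.
have := uniq_leq_size _ sub; rewrite size_map size_iota ltnn map_inj_uniq //.
by rewrite iota_uniq => /(_ isT).
Qed.

Lemma disjoint_avoids_finite (L : nat -> seq V) X :
  (forall m n z, z \in L m -> z \in L n -> m = n) -> finite_set X ->
  exists n, forall z, z \in L n -> ~ X z.
Proof.
move=> dis finX; apply: contrapT => nex.
have /choice[g gP] n : exists z, z \in L n /\ X z.
  apply: contrapT => nz; apply: nex; exists n => z zn Xz; apply: nz.
  by exists z.
apply: (finite_set_no_injection finX (g := g)) => [n|m n E]; first by have [] := gP n.
have [gm _] := gP m; have [gn _] := gP n.
by apply: dis gm _; rewrite E.
Qed.

Lemma infinite_subsequence (A : nat -> Prop) :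
  (forall N, exists2 i, N <= i & A i) ->
  exists2 idx : nat -> nat, injective idx & forall n, A (idx n).
Proof.
move=> inf; have /choice[next nP] N : exists i, N <= i /\ A i.
  by have [i] := inf N; exists i.
pose idx := fix F n := if n is m.+1 then next (F m).+1 else next 0.
have lt n : idx n < idx n.+1 by have [] := nP (idx n).+1.
have mono m n : m < n -> idx m < idx n.
  elim: n => // n IH; rewrite ltnS leq_eqVlt => /orP[/eqP ->|/IH mn]; first exact: lt.
  exact: ltn_trans mn (lt n).
exists idx; last by case=> [|n]; [have [] := nP 0|have [] := nP (idx n).+1].
by move=> m n E; case: (ltngtP m n) => // /mono; rewrite E ltnn.
Qed.

Lemma ray_comb G R A : ray G R -> (forall N, exists2 i, N <= i & A (R i)) ->
  has_comb G R A.
Proof.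
move=> rR /(@infinite_subsequence (fun i => A (R i)))[idx idxI idxA].
split=> //; exists (R \o idx), (fun=> [::]); split=> [n|n z|m n z|n].
- by split=> //; apply: ray_verts rR.
- by rewrite inE => /eqP ->; split=> // _; exists (idx n).
- by rewrite !inE => /eqP -> /eqP /rR.1 /idxI.
- exact: idxA.
Qed.

(** The paths are chosen one after the other, each avoiding, apart from [v], the list [acc n] of
    vertices used before. *)
Lemma dominates_of_fan G v R :
  (forall s : seq V, exists2 p, AB_path G [set v] (range R `\ v) v p &
     forall z, z \in v :: p -> z \in s -> z = v) ->
  dominates G v R.
Proof.
move=> fan; have /choice[F FP] (s : seq V) : exists p,
    AB_path G [set v] (range R `\ v) v p /\ forall z, z \in v :: p -> z \in s -> z = v.
  by have [p] := fan s; exists p.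
pose acc := fix acc n := if n is m.+1 then acc m ++ F (acc m) else [::].
have sub m n z : m <= n -> z \in acc m -> z \in acc n.
  elim: n => [|n IH]; first by rewrite leqn0 => /eqP ->.
  by rewrite leq_eqVlt => /orP[/eqP -> //|/IH H /H]; rewrite /= mem_cat => ->.
exists (F \o acc); split=> [n|]; first exact: (FP (acc n)).1.
move=> m n z; wlog mn : m n / m < n => [H nmn zm zn|_ zm zn].
  by case: (ltngtP m n) => [mn|nm|//]; [apply: (H m n)|apply: (H n m) => //; apply: nesym].
case: (pselect (z = v)) => // zv; apply: (FP (acc n)).2 => //.
apply: (sub m.+1) => //=; rewrite mem_cat; move: zm; rewrite inE => /orP[/eqP //|->].
by rewrite orbT.
Qed.

End Rays.

(** * Rooted trees given by a parent function *)

Section ParentTrees.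
Variable V : choiceType.
Implicit Types (G T : graph V) (r x y z u v : V) (P : V -> V) (h : V -> nat).
Implicit Types (D U X : set V) (Q R : nat -> V).

(* [h] may be any rank function decreasing strictly towards the root, so that a
   tree on a subset of the vertices can inherit the ranks of a given tree. *)
Record parent_tree T r P h : Prop := ParentTree {
  pt_root : verts T r;
  pt_parent_root : P r = r;
  pt_verts : forall x, verts T x -> verts T (P x);
  pt_height : forall x, verts T x -> x <> r -> h (P x) < h x;
  pt_adj : forall x y, adj T x y <->
    [/\ verts T x, verts T y & (x <> r /\ P x = y) \/ (y <> r /\ P y = x)]
}.

Definition anc P x y := exists n, iter n P y = x.

Definition chain P D := forall x y, D x -> D y -> anc P x y \/ anc P y x.
Definition down_closed P D := forall x y, D y -> anc P x y -> D x.
(** An unbounded down-closed chain of a tree is the vertex set of a ray from the root; such chains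
    stand for the ends of the tree. *)
Definition unbounded h D := forall n, exists2 x, D x & n <= h x.

Lemma anc_refl P x : anc P x x. Proof. by exists 0. Qed.

Lemma anc_parent P x : anc P (P x) x. Proof. by exists 1. Qed.

Lemma anc_trans P y x z : anc P x y -> anc P y z -> anc P x z.
Proof. by move=> [n <-] [m <-]; exists (n + m); rewrite iterD. Qed.

Lemma anc_chain P z : chain P [set x | anc P x z].
Proof.
move=> _ _ [n <-] [m <-].
wlog nm : n m / n <= m => [W|]; last first.
  by right; exists (m - n); rewrite -iterD subnK.
by case/orP: (leq_total n m) => /W // [] ?; [right|left].
Qed.

Lemma anc_strict P x y : anc P x y -> x <> y -> anc P x (P y).
Proof.
by move=> [[|n] <-] // _; exists n; rewrite -iterSr.
Qed.

Lemma anc_child P x y : anc P x y -> x <> y ->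
  exists z, [/\ P z = x, z <> x & anc P z y].
Proof.
move=> [n]; elim: n => [<-//|n IH] /= Ex xy.
case: (pselect (iter n P y = x)) => [/IH//|nx]; first exact.
by exists (iter n P y); split=> //; exists n.
Qed.

Section Theory.
Variables (T : graph V) (r : V) (P : V -> V) (h : V -> nat).
Hypothesis PT : parent_tree T r P h.

Local Notation anc := (anc P).

Lemma anc_verts x y : verts T y -> anc x y -> verts T x.
Proof.
by move=> Ty [n <-]; elim: n => //= n; apply: pt_verts PT _.
Qed.

Lemma anc_root x : verts T x -> anc r x.
Proof.
have [n] := ubnP (h x); elim: n => // n IH in x *; rewrite ltnS => hx Tx.
case: (pselect (x = r)) => [->|xr]; first exact: anc_refl.
apply: anc_trans (anc_parent P x); apply: IH (pt_verts PT Tx).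
exact: leq_trans (pt_height PT Tx xr) hx.
Qed.

Lemma parent_ind (A : V -> Prop) : A r ->
  (forall x, verts T x -> x <> r -> A (P x) -> A x) -> forall x, verts T x -> A x.
Proof.
move=> Ar step x; have [n] := ubnP (h x); elim: n => // n IH in x *.
rewrite ltnS => hx Tx; case: (pselect (x = r)) => [->//|xr].
apply: step => //; apply: IH (pt_verts PT Tx).
exact: leq_trans (pt_height PT Tx xr) hx.
Qed.

Lemma finite_anc x : verts T x -> finite_set [set y | anc y x].
Proof.
move: x; apply: parent_ind => [|x Tx xr IH].
  apply: sub_finite_set (finite_set1 r) => y [n <-] /=.
  by elim: n => //= n ->; rewrite (pt_parent_root PT).
apply: (@sub_finite_set _ _ ([set x] `|` [set y | anc y (P x)])).
  move=> y yx; case: (pselect (y = x)) => [|/(anc_strict yx)]; by [left|right].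
by rewrite finite_setU.
Qed.

Lemma parent_height x : verts T x -> h (P x) <= h x.
Proof.
move=> Tx; case: (pselect (x = r)) => [->|xr]; first by rewrite (pt_parent_root PT).
by apply: ltnW; apply: pt_height PT _ _ _.
Qed.

Lemma anc_height x y : verts T y -> anc x y -> h x <= h y.
Proof.
move=> Ty [n <-]; elim: n => //= n IH; apply: leq_trans IH.
by apply: parent_height; apply: anc_verts Ty _; exists n.
Qed.

Lemma anc_height_lt x y : verts T y -> anc x y -> x <> y -> h x < h y.
Proof.
move=> Ty xy nxy; have [n E] := anc_strict xy nxy.
have yr : y <> r.
  move=> E'; apply: nxy; rewrite -E E'.
  by elim: n {E} => [|n IH]; rewrite ?iterSr (pt_parent_root PT).
apply: leq_ltn_trans (pt_height PT Ty yr).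
by apply: anc_height; [apply: pt_verts PT _ _|exists n].
Qed.

Lemma anc_antisym x y : verts T y -> anc x y -> anc y x -> x = y.
Proof.
move=> Ty xy yx; apply: contrapT => nxy.
have := anc_height_lt Ty xy nxy; rewrite ltnNge => /negP; apply.
exact: anc_height (anc_verts Ty xy) yx.
Qed.

Lemma anc_of_height x y D : chain P D -> D x -> D y -> verts T x ->
  h x < h y -> anc x y.
Proof.
move=> cD Dx Dy Tx xy; case: (cD _ _ Dx Dy) => // /(anc_height Tx).
by rewrite leqNgt xy.
Qed.

Lemma anc_root_eq x : anc x r -> x = r.
Proof.
move=> xr; apply: (anc_antisym (pt_root PT) xr).
by apply: anc_root; apply: anc_verts (pt_root PT) xr.
Qed.

Lemma anc_strict_neq x y : verts T y -> y <> r -> anc x (P y) -> x <> y.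
Proof.
move=> Ty yr xPy E; have := pt_height PT Ty yr; rewrite ltnNge -{1}E.
by move/negP; apply; apply: anc_height xPy; apply: pt_verts PT _ Ty.
Qed.

Lemma parent_adj x : verts T x -> x <> r -> adj T x (P x).
Proof.
by move=> Tx xr; apply/(pt_adj PT); split; [|exact: pt_verts PT _ Tx|left].
Qed.

Lemma subtree_exit u a b : adj T a b -> anc u a -> ~ anc u b ->
  [/\ a = u, b = P u & u <> r].
Proof.
case/(pt_adj PT) => _ _ [[ar <-]|[br <-]] ua nub.
  case: (pselect (u = a)) => [Ea|/(anc_strict ua)//].
  by subst a.
by case: nub; apply: anc_trans ua (anc_parent P b).
Qed.

(** The only edge leaving the subtree above [u] joins [u] to [P u]. A path that crossed over and
    came back would use this edge in both directions and repeat one of its ends. *)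
Lemma subtree_convex u x p z : gpath T x p -> z \in x :: p ->
  (anc u x <-> anc u (last x p)) -> (anc u z <-> anc u x).
Proof.
move=> [_ px ux] /splitPl zp; case: zp px ux => p1 p2 lp1.
rewrite cat_path lp1 last_cat lp1 -cat_cons cat_uniq.
move=> /andP[p1x p2z] /and3P[_ /hasPn dis _] E.
apply: contrapT => nE.
have [a [b [ab Ha Hb ap _]]] : exists a b, [/\ adj T a b, anc u a <-> anc u x,
  ~ (anc u b <-> anc u x), a \in x :: p1 & b \in p1].
  by apply: (@path_cross V T [set a | anc u a <-> anc u x]) => //; rewrite /= lp1.
have [c [d [cd Hc Hd cp dp]]] : exists a b, [/\ adj T a b, ~ (anc u a <-> anc u x),
  ~ ~ (anc u b <-> anc u x), a \in z :: p2 & b \in p2].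
  apply: (@path_cross V T [set a | ~ (anc u a <-> anc u x)]) => //= nn.
  by apply: nn; split=> /E.
case: (pselect (anc u x)) => ux.
- have [ua ub] : anc u a /\ ~ anc u b by split; apply: contrapT; tauto.
  have [uc ud] : ~ anc u c /\ anc u d by split; apply: contrapT; tauto.
  have [E1 _ _] := subtree_exit ab ua ub.
  rewrite adj_sym in cd; have [E2 _ _] := subtree_exit cd ud uc.
  by move/dis: dp; rewrite E2 -E1 /= ap.
- have [ua ub] : ~ anc u a /\ anc u b by split; apply: contrapT; tauto.
  have [uc ud] : anc u c /\ ~ anc u d by split; apply: contrapT; tauto.
  rewrite adj_sym in ab; have [_ E1 _] := subtree_exit ab ub ua.
  have [_ E2 _] := subtree_exit cd uc ud.
  by move/dis: dp; rewrite E2 -E1 /= ap.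
Qed.

Lemma component_anc G U x y : subgraph T G -> verts T y -> anc x y ->
  (forall z, anc x z -> anc z y -> U z) -> component (induced G U) y x.
Proof.
move=> [TG TGa] Ty [n]; elim: n y Ty => [|n IH] y Ty xy Uxy.
  rewrite /= in xy; rewrite xy; apply: component_refl; split.
    by apply: TG; rewrite -xy.
  by apply: Uxy; [|rewrite xy]; apply: anc_refl.
rewrite iterSr in xy.
have xPy : anc x (P y) by exists n.
have c : component (induced G U) (P y) x.
  apply: IH xy _; first exact: pt_verts PT _ Ty.
  by move=> z xz zPy; apply: Uxy xz (anc_trans zPy (anc_parent P y)).
case: (pselect (y = r)) => [E|yr].
  by move: c; rewrite E (pt_parent_root PT).
apply: component_trans c; apply: component_adj; apply/adj_induced; split.
- by apply: TGa; apply: parent_adj.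
- by apply: Uxy (anc_refl P y); apply: anc_trans xPy (anc_parent P y).
- by apply: Uxy (anc_parent P y).
Qed.

Lemma subgraph_refl G : subgraph G G. Proof. by split. Qed.

Lemma component_subtree u x y : verts T u ->
  verts T x /\ anc u x -> verts T y /\ anc u y ->
  component (induced T [set t | verts T t /\ anc u t]) x y.
Proof.
move=> Tu [Tx ux] [Ty uy].
suff H z : verts T z -> anc u z ->
    component (induced T [set t | verts T t /\ anc u t]) z u.
  by apply: component_trans (H _ Tx ux) _; apply: component_sym; apply: H.
move=> Tz uz; apply: (component_anc (subgraph_refl T)) => // t ut tz; split=> //.
exact: anc_verts tz.
Qed.

Lemma parent_tree_connected : connected T.
Proof.
split; first by exists r; apply: pt_root PT.
move=> x y Tx Ty; have := component_subtree (pt_root PT) (conj Tx (anc_root Tx))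
  (conj Ty (anc_root Ty)).
by apply: component_sub => // a b /adj_induced[].
Qed.

Lemma seq_argmax (s : seq V) x0 : x0 \in s ->
  exists2 x, x \in s & forall y, y \in s -> h y <= h x.
Proof.
elim: s x0 => // x s IH x0 _; case: s IH => [|a s] IH.
  by exists x; rewrite ?mem_head // => y; rewrite inE => /eqP ->.
have [z zs zmax] := IH a (mem_head _ _).
case/orP: (leq_total (h x) (h z)) => xz.
  exists z; first by rewrite inE zs orbT.
  by move=> y; rewrite inE => /orP[/eqP ->|/zmax].
exists x; first exact: mem_head.
move=> y; rewrite inE => /orP[/eqP -> //|/zmax yz].
exact: leq_trans yz xz.
Qed.

(* The two neighbours of a vertex of maximal height on a cycle would both be
   its parent. *)
Lemma parent_tree_acyclic : acyclic T.
Proof.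
move=> c /andP[cc uc]; case: c cc uc => // x0 c cc uc.
have [x xc xmax] := seq_argmax (mem_head x0 c).
have [i s Es] := rot_to xc.
have nb y : y \in x0 :: c -> adj T x y -> y = P x.
  move=> yc /(pt_adj PT)[_ Ty [[_ //]|[yr E]]].
  by have := pt_height PT Ty yr; rewrite E ltnNge xmax.
rewrite -(size_rot i) Es; move: cc uc; rewrite -(rot_cycle i) -(rot_uniq i) Es.
have sub y : y \in x :: s -> y \in x0 :: c by rewrite -Es mem_rot.
case: s Es sub => [|a s] // _ sub; case/lastP: s sub => [//|s b] sub.
rewrite /= rcons_path last_rcons => /andP[xa /andP[_ bx]].
have -> : a = P x by apply: nb xa; apply: sub; rewrite !inE eqxx orbT.
have -> : b = P x.
  by apply: nb; rewrite 1?adj_sym //; apply: sub; rewrite !inE mem_rcons mem_head !orbT.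
by rewrite mem_rcons mem_head !andbF.
Qed.

Lemma parent_tree_tree : tree T.
Proof. by split; [apply: parent_tree_connected|apply: parent_tree_acyclic]. Qed.

Lemma tree_le_anc x y : tree_le T r x y -> anc x y.
Proof.
case=> p [rp lp xp].
case: (pselect (anc x r)) => [/anc_root_eq ->|nxr].
  by apply: anc_root; rewrite -lp; apply: gpath_verts rp _; apply: mem_last.
apply: contrapT => nxy.
have [] := subtree_convex (u := x) rp xp; first by rewrite lp; split.
by move=> /(_ (anc_refl P x)).
Qed.

Lemma side_down u : verts T u -> u <> r ->
  side T (P u) u = [set t | verts T t /\ anc u t].
Proof.
move=> Tu ur; apply/seteqP; split=> t.
  rewrite /side => ut; split; first exact: component_verts ut.
  apply: component_ind ut; first exact: anc_refl.
  move=> a b ua /and3P[ab e1 e2]; apply: contrapT => ub.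
  have [E1 E2 _] := subtree_exit ab ua ub.
  by move: e2; rewrite E1 E2 eqxx.
move=> tt; have := component_subtree Tu (conj Tu (anc_refl P u)) tt.
apply: component_sub => // a b /adj_induced[ab [Ta ua] [Tb ub]].
have nP : ~ anc u (P u).
  by move=> /(anc_strict_neq Tu ur).
by apply/and3P; split=> //; apply/eqP=> -[E1 E2]; apply: nP; [rewrite -E1|rewrite -E2].
Qed.

Lemma side_up u : verts T u -> u <> r ->
  side T u (P u) = [set t | verts T t /\ ~ anc u t].
Proof.
move=> Tu ur.
have nP : ~ anc u (P u) by move=> /(anc_strict_neq Tu ur).
apply/seteqP; split=> t.
  rewrite /side => ut; split; first exact: component_verts ut.
  apply: (@component_ind _ _ _ _ (fun t => ~ anc u t) nP _ ut) => a b ua /and3P[ab e1 e2] ub.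
  rewrite adj_sym in ab; have [E1 E2 _] := subtree_exit ab ub ua.
  by move: e2; rewrite E1 E2 eqxx.
move=> [Tt ut].
have tor x : verts T x -> ~ anc u x -> component (del_edge T u (P u)) x r.
  move=> Tx nux.
  have := @component_anc T (~` [set t | anc u t]) r x (@subgraph_refl T) Tx (anc_root Tx).
  move=> H; apply: component_sub (H _) => //; last first.
    by move=> z _ zx uz; apply: nux; apply: anc_trans uz zx.
  move=> a b /adj_induced[ab ua ub].
  apply/and3P; split=> //; apply/eqP=> -[E1 E2].
    by apply: ua; rewrite E1; apply: anc_refl.
  by apply: ub; rewrite E2; apply: anc_refl.
apply: component_trans (tor _ (pt_verts PT Tu) nP) _.
by apply: component_sym; apply: tor.
Qed.

(** * Rays and ends of a rooted tree as chains *)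

Lemma unbounded_of_progress D :
  (exists x, D x) -> (forall x, D x -> exists2 y, D y & h x < h y) -> unbounded h D.
Proof.
move=> [x0 Dx0] prog; elim=> [|n [x Dx nx]]; first by exists x0.
by have [y Dy xy] := prog _ Dx; exists y => //; apply: leq_ltn_trans xy.
Qed.

Lemma bounded_has_max D : D `<=` verts T -> chain P D -> (exists x, D x) ->
  ~ unbounded h D -> exists2 t, D t & forall u, D u -> anc u t.
Proof.
move=> DT cD D0 nun; apply: contrapT => nmax; apply: nun.
apply: unbounded_of_progress => // x Dx; apply: contrapT => nx; apply: nmax.
exists x => // u Du; case: (cD _ _ Du Dx) => // xu.
case: (pselect (x = u)) => [->|xneu]; first exact: anc_refl.
by case: nx; exists u => //; apply: anc_height_lt xu xneu; apply: DT.
Qed.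

(** Each [x] in [D] has a higher vertex of [D] above it, hence a child in [D], and the ray climbs
    from [r] through such children. Its [n]-th vertex has height at least [n], so from index
    [(h u).+1] on it lies above [u]. *)
Lemma chain_ray D : D `<=` verts T -> chain P D -> down_closed P D -> unbounded h D ->
  exists2 R, ray T R & forall u, D u -> has_tail_in R (D `&` [set t | anc u t]).
Proof.
move=> DT cD dD uD.
have Dr : D r.
  by have [x Dx _] := uD 0; apply: (dD _ _ Dx); apply: anc_root; apply: DT.
have step x : exists y, D x -> [/\ D y, P y = x & y <> x].
  case: (pselect (D x)) => [Dx|]; last by exists x.
  have [t Dt xt] := uD (h x).+1.
  have axt : anc x t by apply: (anc_of_height cD Dx Dt (DT _ Dx) xt).
  have [|z [Pz zx zt]] := anc_child axt; first by move=> E; rewrite E ltnn in xt.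
  by exists z => _; split=> //; apply: dD zt.
have [s sP] := choice step.
have DR n : D (iter n s r) by elim: n => //= n /sP[].
have lt n : h (iter n s r) < h (iter n.+1 s r).
  have [Ds Ps ns] := sP _ (DR n); rewrite -{1}Ps; apply: (pt_height PT); first exact: DT.
  by move=> E; apply: ns; rewrite -{2}Ps E (pt_parent_root PT).
have mono n m : n < m -> h (iter n s r) < h (iter m s r).
  elim: m => // m IH; rewrite ltnS leq_eqVlt => /orP[/eqP ->|/IH nm]; first exact: lt.
  exact: ltn_trans nm (lt m).
have ge n : n <= h (iter n s r) by elim: n => // n /leq_ltn_trans; apply.
exists (fun n => iter n s r).
  split.
    move=> n m /= E; case: (ltngtP n m) => // /mono; rewrite E ltnn //.
  move=> n; have [Ds Ps ns] := sP _ (DR n); rewrite adj_sym; apply/(pt_adj PT).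
  split; [exact: DT|exact: DT|left; split=> // E].
  by apply: ns; rewrite -{2}Ps; move: E => /= ->; rewrite (pt_parent_root PT).
move=> u Du; exists (h u).+1 => n un; split=> //.
by apply: (anc_of_height cD) => //; [apply: DT|apply: leq_trans un (ge n)].
Qed.

(** For rays of [T] this chain encodes the end: [ray_equiv_chain] and [ray_chain_equiv] show that
    two rays are equivalent exactly if their chains agree. *)
Definition ray_chain Q :=
  [set u | verts T u /\ has_tail_in Q [set t | verts T t /\ anc u t]].

Lemma subtree_boundary u : boundary_of T [set t | verts T t /\ anc u t] [set P u].
Proof.
split=> // x y xy [Tx ux] nuy.
have nuy' : ~ anc u y by move=> uy; apply: nuy; split=> //; apply: adj_vertsr xy.
by have [_ -> _] := subtree_exit xy ux nuy'.
Qed.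

Lemma ray_chain_down Q : down_closed P (ray_chain Q).
Proof.
move=> x y [Ty tQ] xy; split; first exact: anc_verts xy.
by apply: tail_in_sub tQ => t [Tt yt]; split=> //; apply: anc_trans yt.
Qed.

Lemma ray_chain_chain Q : chain P (ray_chain Q).
Proof.
move=> x y [_ tx] [_ ty].
have [n [[_ xn] [_ yn]]] := tail_in_exists (tail_in_cap tx ty).
exact: anc_chain xn yn.
Qed.

(** A ray with a tail above [x] eventually avoids [x] itself. From then on it stays above one child
    [d] of [x], since leaving that subtree means passing through [P d = x]. *)
Lemma ray_chain_unbounded Q : ray T Q -> unbounded h (ray_chain Q).
Proof.
move=> rQ; apply: unbounded_of_progress.
  exists r; split; first exact: pt_root PT.
  exists 0 => n _; have TQ := ray_verts n rQ; split=> //; exact: anc_root.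
move=> x [Tx tx].
have := tail_in_cap tx (ray_avoids_finite rQ (finite_set1 x)).
case=> n0 tn; have [[Tn xn] nx] := tn _ (leqnn n0).
have [|d [Pd dx dn]] := anc_child xn; first by move=> E; apply: nx.
have Td := anc_verts Tn dn.
have dr : d <> r by move=> E; apply: dx; rewrite -Pd E (pt_parent_root PT).
exists d; last by rewrite -Pd; apply: (pt_height PT).
split=> //; exists n0 => m; elim: m => [|m IH].
  by rewrite leqn0 => /eqP <-.
rewrite leq_eqVlt => /orP[/eqP <-//|nm].
have [_ dm] := IH nm; split; first exact: ray_verts rQ.
apply: contrapT => ndm; have [_ E _] := subtree_exit (rQ.2 m) dm ndm.
have [//|_] := tn m.+1 _; first exact: ltnW.
by apply; rewrite E Pd.
Qed.

(** Some element of [D] is higher than [u], hence above [u] in the chain of [Q]. So an unbounded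
    down-closed part of the chain is all of it. *)
Lemma ray_chain_sub D Q u : unbounded h D -> D `<=` ray_chain Q -> down_closed P D ->
  ray_chain Q u -> D u.
Proof.
move=> uD DQ dD Qu; have [t Dt ut] := uD (h u).+1.
apply: (dD _ _ Dt); apply: anc_of_height ut; [exact: ray_chain_chain|by []|exact: DQ|].
by case: Qu.
Qed.

Lemma seq_bounded_height (s : seq V) : exists M, forall x, x \in s -> h x <= M.
Proof.
elim: s => [|x s [M IH]]; first by exists 0.
exists (maxn (h x) M) => y; rewrite inE => /orP[/eqP ->|/IH yM].
  exact: leq_maxl.
by rewrite (leq_trans yM) ?leq_maxr.
Qed.

Lemma ray_chain_equiv D R Q : unbounded h D -> D `<=` ray_chain R ->
  D `<=` ray_chain Q -> ray_equiv T R Q.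
Proof.
move=> uD DR DQ; apply: ray_equiv_of_common => X /finite_seqP[s ->].
have [M sM] := seq_bounded_height s.
have [u Du Mu] := uD M.+1; have [Tu tR] := DR _ Du; have [_ tQ] := DQ _ Du.
exists [set t | verts T t /\ anc u t]; split=> //.
  move=> t [Tt ut] /sM; rewrite leqNgt; apply/negP/negPn.
  exact: leq_trans Mu (anc_height Tt ut).
by move=> x y; apply: component_subtree.
Qed.

Lemma ray_equiv_chain R Q : ray T R -> ray T Q -> ray_equiv T R Q ->
  ray_chain R = ray_chain Q.
Proof.
move=> rR rQ RQ.
have sub : ray_chain R `<=` ray_chain Q.
  move=> u [Tu tu]; split=> //.
  exact: ray_equiv_tail rQ (subtree_boundary u) RQ tu.
apply/seteqP; split=> // u; apply: ray_chain_sub => //.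
- exact: ray_chain_unbounded.
- exact: ray_chain_down.
Qed.

End Theory.
End ParentTrees.

(** * Parent functions of rooted trees, and feet on a normal tree *)

Section NormalTrees.
Variable V : choiceType.
Implicit Types (G T : graph V) (r x y z u v : V) (P f : V -> V) (h : V -> nat).
Implicit Types (K : set V).

Lemma parent_tree_exists K r P h : K r -> P r = r -> (forall x, K x -> K (P x)) ->
  (forall x, K x -> x <> r -> h (P x) < h x) ->
  exists2 T, parent_tree T r P h & verts T = K.
Proof.
move=> Kr Pr KP Kh.
pose e := fun x y => `[< [/\ K x, K y & (x <> r /\ P x = y) \/ (y <> r /\ P y = x)] >].
have esym : symmetric e.
  by move=> x y; apply/asboolP/asboolP=> -[? ? []]; split=> //; by [right|left].
have eirr : irreflexive e.
  move=> x; apply/asboolP=> -[Kx _ [[xr E]|[xr E]]].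
    by have := Kh _ Kx xr; rewrite E ltnn.
  by have := Kh _ Kx xr; rewrite E ltnn.
have ev x y : e x y -> K x by move/asboolP=> [].
exists (Graph esym eirr ev) => //; split=> //= x y.
by split=> /asboolP.
Qed.

(** The height is the distance from the root, and the parent is the last but one vertex of a
    shortest walk. That heights drop by exactly one is what later lets [last_cut] recurse on the
    height. *)
Lemma rooted_tree_parent T r : rooted_tree T r -> exists P h,
  parent_tree T r P h /\ forall x, verts T x -> x <> r -> (h (P x)).+1 = h x.
Proof.
move=> [[[_ conT] acyT] Tr].
pose walk x n := exists p, [/\ path (adj T) r p, last r p = x & size p = n].
have /choice[h hP] x : exists n, verts T x ->
    walk x n /\ forall m, walk x m -> n <= m.
  case: (pselect (verts T x)) => [Tx|]; last by exists 0.
  have [p [_ rp _] lp] := conT _ _ Tr Tx.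
  have ex : exists n, `[< walk x n >] by exists (size p); apply/asboolP; exists p.
  case: (ex_minnP ex) => n /asboolP wn nmin; exists n => _; split=> // m wm.
  by apply: nmin; apply/asboolP.
have /choice[P PP] x : exists y, (x = r -> y = r) /\
    (verts T x -> x <> r -> adj T x y /\ (h y).+1 = h x).
  case: (pselect (x = r)) => [->|xr]; first by exists r.
  case: (pselect (verts T x)) => [Tx|]; last by exists x.
  have [[p [rp lp sp]] hmin] := hP _ Tx.
  case/lastP: p rp lp sp => [|p y]; first by move=> _ /= E; case: xr.
  rewrite rcons_path last_rcons size_rcons => /andP[rp yx] Ey hx; subst y.
  exists (last r p); split=> [/xr//|_ _].
  rewrite adj_sym; split=> //.
  have Tl := adj_verts yx.
  have [[q [rq lq sq]] lmin] := hP _ Tl.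
  apply/eqP; rewrite eqn_leq -{1}hx ltnS lmin; last by exists p.
  by apply: hmin; exists (rcons q x); rewrite rcons_path last_rcons size_rcons rq lq sq.
have Pr : P r = r by apply: (PP r).1.
have TP x : verts T x -> verts T (P x).
  move=> Tx; case: (pselect (x = r)) => [->|xr]; first by rewrite Pr.
  exact: adj_vertsr ((PP x).2 Tx xr).1.
have hSP x : verts T x -> x <> r -> (h (P x)).+1 = h x by move=> Tx xr; apply: ((PP x).2 Tx xr).2.
exists P, h; split=> //.
have [|T' PT' ET'] := parent_tree_exists (h := h) Tr Pr TP.
  by move=> x Tx xr; rewrite -(hSP x).
have sub x y : adj T' x y -> adj T x y.
  case/(pt_adj PT'); rewrite ET' => Tx Ty [[xr <-]|[yr <-]].
    exact: ((PP x).2 Tx xr).1.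
  by rewrite adj_sym; apply: ((PP y).2 Ty yr).1.
split=> // [x Tx xr|x y]; first by rewrite -(hSP x).
rewrite -ET'; apply: iff_trans (pt_adj PT' x y); split=> [xy|/sub//].
have [T'x T'y] : verts T' x /\ verts T' y.
  by rewrite ET'; split; [apply: adj_verts xy|apply: adj_vertsr xy].
(* An edge of [T] outside [T'] would close a cycle with a path of [T']. *)
have [p [_ xp up] lp] := (parent_tree_connected PT').2 _ _ T'x T'y.
have /acyT : ucycle (adj T) (x :: p).
  rewrite /ucycle up andbT /= rcons_path lp adj_sym xy andbT.
  by apply: sub_path xp.
case: p lp xp {up} => [|a [|//]] /= lp; first by move: xy; rewrite lp adj_irr.
by rewrite lp andbT.
Qed.

(* [f v] is the top of the chain formed by the neighbours in [T] of the component of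
   [G - T] containing [v]; on [T] it is the identity. *)
Record foot_map G T P f : Prop := FootMap {
  foot_id : forall x, verts T x -> f x = x;
  foot_verts : forall v, verts G v -> verts T (f v);
  foot_adj : forall u v, adj G u v -> anc P (f u) (f v) \/ anc P (f v) (f u);
  foot_out : forall u v, adj G u v -> ~ verts T u -> ~ verts T v -> f u = f v;
  foot_above : forall u v, adj G u v -> verts T u -> ~ verts T v -> anc P u (f v);
  foot_reach : forall v, verts G v ->
    component (induced G [set u | f u = f v]) v (f v)
}.

(** Two neighbours in [T] of a component of [G - T] are the ends of a [T]-path through that
    component, so normality makes the neighbours a chain. It is non-empty as [G] is connected and
    finite by assumption, hence has a top. *)
Lemma foot_map_exists G T r P h : connected G -> normal_tree G T r ->
  parent_tree T r P h ->
  (forall x, verts (induced G (~` verts T)) x ->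
     finite_set (neighbourhood G (component (induced G (~` verts T)) x))) ->
  exists f, foot_map G T P f.
Proof.
move=> conG [[TG TGa] _ norm] PT finN.
pose W := verts T; pose comp := component (induced G (~` W)).
have compW v u : comp v u -> ~ W u by move=> /component_verts[].
have compG v u : comp v u -> verts G u by move=> /component_verts[].
have comp_adj v u z : comp v u -> adj G u z -> ~ W z -> comp v z.
  move=> vu uz Wz; apply: (component_trans vu); apply: component_adj.
  by apply/adj_induced; split=> //; apply: compW vu.
pose F v := neighbourhood G (comp v).
have FP v z : F v z <-> exists u, [/\ comp v u, adj G u z & W z].
  split=> [[Gz [nz [u vu uz]]]|[u [vu uz Wz]]].
    exists u; split=> //; apply: contrapT => nWz; apply: nz.
    exact: comp_adj vu uz nWz.
  split; first exact: adj_vertsr uz.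
  by split; [move=> /compW|exists u].
have comparable u v : adj G u v -> W u -> W v -> anc P u v \/ anc P v u.
  move=> uv Wu Wv; case: (boolP (adj T u v)) => [/(pt_adj PT)[_ _]|nuv].
    by case=> -[_ <-]; [right|left]; apply: anc_parent.
  have : H_path G T u [:: v].
    split=> //.
    - split=> //=; rewrite ?uv //; first exact: TG.
      rewrite inE andbT; apply/negP=> /eqP E; by rewrite E adj_irr in uv.
    - move=> z; rewrite !inE => /orP[] /eqP ->; split=> // _; by [left|right].
    - by move=> [a b]; rewrite /path_edges /= inE => /eqP[-> ->].
  by case/norm => /(tree_le_anc PT); [left|right].
have Fchain v : chain P (F v).
  move=> z z' /FP[u [vu uz Wz]] /FP[u' [vu' uz' Wz']].
  case: (pselect (z = z')) => [->|zz']; first by left; apply: anc_refl.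
  have [p [_ up pu] lp] := component_trans (component_sym vu) vu'.
  have cp : gpath (induced G (~` W)) u p.
    by split=> //; split; [apply: compG vu|apply: compW vu].
  have pW a : a \in u :: p -> ~ W a by move=> /(gpath_verts cp)[].
  have zp : z \notin u :: p by apply/negP=> /pW.
  have zp' : z' \notin u :: p by apply/negP=> /pW.
  have : H_path G T z (u :: rcons p z').
    split=> //.
    - split; first exact: TG.
        rewrite /= adj_sym uz rcons_path lp uz' andbT.
        by apply: sub_path up => a b /adj_induced[].
      rewrite -rcons_cons cons_uniq mem_rcons inE rcons_uniq (negPf zp) zp' pu.
      by rewrite orbF !andbT; apply/eqP.
    - move=> a; rewrite inE -rcons_cons mem_rcons inE => ap.
      rewrite /= last_rcons; split=> [Wa|[]->//].
      case/or3P: ap => [/eqP|/eqP|/pW //]; by [left|right].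
    - move=> [a b]; rewrite /path_edges /= inE => /orP[/eqP[-> ->]|].
        apply/negP=> /adj_vertsr; apply: pW; exact: mem_head.
      (* Only the position of the pair [(a, b)] matters here, so [path_edgesP] is applied with the
         relation that always holds: [a] then lies on [u :: p], outside [T]. *)
      have pp : path (fun _ _ => true) u (rcons p z').
        by elim: (rcons _ _) u {up pu lp cp pW zp zp' vu uz} => //=.
      case/(path_edgesP pp) => _; rewrite belast_rcons => ap _.
      by apply/negP=> /adj_verts; apply: pW.
  by case/norm => /(tree_le_anc PT); rewrite /= last_rcons; [left|right].
have Fne v : verts G v -> ~ W v -> exists z, F v z.
  move=> Gv Wv; apply: contrapT => nF.
  have Gr : verts G r by apply: TG; apply: pt_root PT.
  have := conG.2 _ _ Gv Gr.
  have vv : comp v v by apply: component_refl.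
  move/(component_ind vv) => H; apply: (compW v r) (pt_root PT); apply: H.
  move=> a b va ab; apply: (comp_adj _ _ _ va ab) => Wb.
  by apply: nF; exists b; apply/FP; exists a.
have FW v z : F v z -> W z by move=> /FP[u []].
have Ftop v : verts G v -> ~ W v -> exists2 z, F v z & forall z', F v z' -> anc P z' z.
  move=> Gv Wv; apply: (bounded_has_max PT (FW v) (Fchain v) (Fne _ Gv Wv)).
  have /finite_seqP[s Fs] : finite_set (F v) by apply: finN.
  have [M sM] := seq_bounded_height h s.
  by move=> /(_ M.+1)[x]; rewrite Fs => /sM; rewrite leqNgt => /negP.
have /choice[f fP] v : exists z, (W v -> z = v) /\
    (verts G v -> ~ W v -> F v z /\ forall z', F v z' -> anc P z' z).
  case: (pselect (W v)) => Wv; first by exists v.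
  case: (pselect (verts G v)) => Gv; last by exists v.
  by have [z Fz zm] := Ftop _ Gv Wv; exists z.
have fid x : W x -> f x = x by move=> Wx; apply: (fP x).1.
have fW v : verts G v -> W (f v).
  move=> Gv; case: (pselect (W v)) => Wv; first by rewrite fid.
  by have [/FW] := (fP v).2 Gv Wv.
have fcomp v u : verts G v -> ~ W v -> comp v u -> f v = f u.
  move=> Gv Wv vu.
  have [Fv vm] := (fP v).2 Gv Wv; have [Fu um] := (fP u).2 (compG _ _ vu) (compW _ _ vu).
  have E z : F v z <-> F u z.
    split=> /FP[a [va az Wz]]; apply/FP; exists a; split=> //.
      by apply: component_trans va; apply: component_sym.
    by apply: component_trans va.
  apply: (anc_antisym PT (fW _ (compG _ _ vu))).
    by apply: um; apply/E.
  by apply: vm; apply/E.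
have fout u v : adj G u v -> ~ W u -> ~ W v -> f u = f v.
  move=> uv Wu Wv; have Gu := adj_verts uv; apply: fcomp => //.
  by apply: component_adj; apply/adj_induced.
have fab u v : adj G u v -> W u -> ~ W v -> anc P u (f v).
  move=> uv Wu Wv; have Gv := adj_vertsr uv.
  apply: ((fP v).2 Gv Wv).2; apply/FP; exists v; rewrite adj_sym; split=> //.
  by apply: component_refl.
exists f; split=> //.
- move=> u v uv; have Gu := adj_verts uv; have Gv := adj_vertsr uv.
  case: (pselect (W u)) => Wu; case: (pselect (W v)) => Wv.
  + by rewrite !fid //; apply: comparable.
  + by left; rewrite (fid u) //; apply: fab.
  + by right; rewrite (fid v) //; apply: fab; rewrite 1?adj_sym.
  + by left; rewrite (fout u v) //; apply: anc_refl.
- move=> v Gv; case: (pselect (W v)) => Wv.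
    by rewrite fid //; apply: component_refl; split=> //=; rewrite fid.
  have [/FP[u [vu uz Wz]] _] := (fP v).2 Gv Wv.
  have [fu vu'] : f u = f v /\ component (induced G [set u | f u = f v]) v u.
    have := vu; apply: (@component_ind _ _ _ _
      (fun u => f u = f v /\ component (induced G [set u | f u = f v]) v u)).
      by split=> //; apply: component_refl.
    move=> a b [fa va] /adj_induced[ab Wa Wb].
    have fb : f b = f v by rewrite -fa; apply: fout; rewrite 1?adj_sym.
    by split=> //; apply: (component_trans va); apply: component_adj; apply/adj_induced.
  apply: (component_trans vu'); apply: component_adj; apply/adj_induced.
  by split=> //=; rewrite fid.
Qed.

End NormalTrees.

Lemma separator_sym (V N : choiceType) (part : N -> set V) t1 t2 :
  separator part t1 t2 = separator part t2 t1.
Proof. exact: setIC. Qed.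

(** * The sets above tree vertices and their separating intervals *)

Section Decomposition.
Variables (V : choiceType) (G T : graph V) (r : V) (P f : V -> V) (h : V -> nat).
Hypotheses (TG : subgraph T G) (PT : parent_tree T r P h)
  (hS : forall x, verts T x -> x <> r -> (h (P x)).+1 = h x)
  (FM : foot_map G T P f).
Implicit Types (s t u v x y z a b c d : V).

Local Notation W := (verts T).
Local Notation ancestor := (@anc V).
Local Notation anc := (anc P).

(* For [t] in [T], the component of [t] in the graph obtained from [G] by deleting
   the vertices strictly below [t] in [T]. *)
Definition up_comp t := [set v | verts G v /\ anc t (f v)].

Definition bd t := neighbourhood G (up_comp t).

(* The interval of [T] from the least neighbour of [up_comp t] to the parent of [t]. *)
Definition interval t := [set x | anc x (P t) /\ exists2 a, bd t a & anc a x].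

(** Adjacent vertices have comparable feet, so the foot of [a] is strictly below [t]. If [a] were
    outside [T], its foot would be at or above that of its neighbour [u] in [up_comp t], and thus
    above [t]. *)
Lemma bd_strict t a : W t -> bd t a -> [/\ W a, t <> r & anc a (P t)].
Proof.
move=> Wt [Ga [nCa [u [Gu tu] ua]]].
have nta : ~ anc t (f a) by move=> ta; apply: nCa.
have fau : anc (f a) (f u).
  by case: (foot_adj FM ua) => // /(anc_trans tu)/nta.
have Wfa := foot_verts FM Ga.
have fat : anc (f a) t.
  by case: (anc_chain fau tu) => // /nta.
have Wa : W a.
  apply: contrapT => nWa; case: (pselect (W u)) => Wu; last first.
    by apply: nta; rewrite -(foot_out FM ua Wu nWa).
  by apply: nta; apply: (anc_trans tu); rewrite (foot_id FM Wu); apply: foot_above FM _ _ ua Wu nWa.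
rewrite (foot_id FM Wa) in fat nta.
split=> //; first by move=> E; apply: nta; rewrite E; apply: anc_root PT _ Wa.
by apply: anc_strict => // E; apply: nta; rewrite E; apply: anc_refl.
Qed.

Lemma interval_verts t x : W t -> interval t x ->
  [/\ W x, t <> r, x <> t & ~ anc t x].
Proof.
move=> Wt [xt [a /(bd_strict Wt)[_ tr _] _]].
have Wx : W x by apply: anc_verts PT _ _ (pt_verts PT Wt) xt.
have xneqt := anc_strict_neq PT Wt tr xt.
split=> // tx; apply: xneqt; apply: anc_antisym PT _ _ Wt _ tx.
exact: anc_trans xt (anc_parent P t).
Qed.

(** Every vertex reaches its foot through vertices with the same foot, and from there [t] by
    descending in [T]. *)
Lemma up_comp_connected t x y : W t -> up_comp t x -> up_comp t y ->
  component (induced G (up_comp t)) x y.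
Proof.
move=> Wt Cx Cy.
suff H z : up_comp t z -> component (induced G (up_comp t)) z t.
  by apply: component_trans (H _ Cx) _; apply: component_sym; apply: H.
move=> [Gz tz]; apply: (@component_trans _ _ (f z)).
  apply: component_sub (foot_reach FM Gz) => //.
  move=> a b /adj_induced[ab /= fa fb]; apply/adj_induced; split=> //.
    by split; [apply: adj_verts ab|rewrite fa].
  by split; [apply: adj_vertsr ab|rewrite fb].
apply: (component_anc PT TG) => //; first exact: foot_verts FM _ Gz.
move=> a ta az; have Wa := anc_verts PT (foot_verts FM Gz) az.
by split; [apply: TG.1|rewrite (foot_id FM Wa)].
Qed.

Lemma up_comp_self t : W t -> up_comp t t.
Proof.
by move=> Wt; split; [apply: TG.1|rewrite (foot_id FM Wt); apply: anc_refl].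
Qed.

Lemma up_comp_root v : verts G v -> up_comp r v.
Proof. by move=> Gv; split=> //; apply: (anc_root PT); apply: foot_verts FM _ Gv. Qed.

Lemma up_comp_sub s t : anc s t -> up_comp t `<=` up_comp s.
Proof. by move=> st v [Gv tv]; split=> //; apply: anc_trans st tv. Qed.

Lemma up_comp_height t v : up_comp t v -> h t <= h (f v).
Proof. by move=> [Gv tv]; apply: anc_height PT _ _ (foot_verts FM Gv) tv. Qed.

Lemma up_comp_finite X : finite_set X ->
  exists M, forall t, M < h t -> up_comp t `<=` ~` X.
Proof.
move=> /finite_seqP[s ->]; have [M sM] := seq_bounded_height h (map f s).
exists M => t Mt v Cv /= vs; have := sM _ (map_f f vs).
by rewrite leqNgt (leq_trans Mt) // up_comp_height.
Qed.

Lemma up_comp_boundary t : W t -> boundary_of G (up_comp t) (interval t).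
Proof.
move=> Wt; split.
  apply: sub_finite_set (finite_anc PT (pt_verts PT Wt)).
  by move=> x [].
move=> x y xy Cx nCy.
have By : bd t y by split; [apply: adj_vertsr xy|split=> //; exists x].
by have [_ _ yt] := bd_strict Wt By; split=> //; exists y => //; apply: anc_refl.
Qed.

(** * The greedy choice of cut vertices, and the bags *)

Fixpoint last_cut_rec n x := if n is n'.+1 then
    if `[< forall a, bd x a -> anc (last_cut_rec n' (P x)) a >] then x
    else last_cut_rec n' (P x)
  else x.

(* A vertex [x] is cut if its interval lies above the last cut vertex strictly below
   [x]; the cut vertices will be the nodes of the decomposition tree. *)
Definition last_cut x := last_cut_rec (h x) x.

Lemma last_cut_root : last_cut r = r.
Proof.
rewrite /last_cut; elim: (h r) => //= n IH.
by rewrite (pt_parent_root PT) IH if_same.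
Qed.

(** Away from the root, [h x] is the successor of [h (P x)], so the recursive call has exactly the
    height of [P x] as its fuel. *)
Lemma last_cutE x : W x -> x <> r -> last_cut x =
  if `[< forall a, bd x a -> anc (last_cut (P x)) a >] then x else last_cut (P x).
Proof. by move=> Wx xr; rewrite {1}/last_cut -hS. Qed.

Lemma last_cut_anc x : W x -> anc (last_cut x) x.
Proof.
move: x; apply: (parent_ind PT) => [|x Wx xr IH].
  by rewrite last_cut_root; apply: anc_refl.
rewrite last_cutE //; case: ifP => _; first exact: anc_refl.
exact: anc_trans IH (anc_parent P x).
Qed.

Definition cuts := [set x | W x /\ last_cut x = x].

Lemma last_cut_cuts x : W x -> cuts (last_cut x).
Proof.
move=> Wx; split; first exact: anc_verts PT _ _ Wx (last_cut_anc Wx).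
move: x Wx; apply: (parent_ind PT) => [|x Wx xr IH].
  by rewrite !last_cut_root.
by rewrite (last_cutE Wx xr); case: ifP => // H; rewrite (last_cutE Wx xr) H.
Qed.

(** With [last_cut_anc] and [last_cut_cuts], this makes [last_cut x] the greatest cut vertex at or
    below [x]. *)
Lemma last_cut_max c x : W x -> cuts c -> anc c x -> anc c (last_cut x).
Proof.
move=> Wx Kc; move: x Wx; apply: (parent_ind PT) => [|x Wx xr IH].
  by rewrite last_cut_root.
move=> cx; case: (pselect (c = x)) => [<-|/(anc_strict cx)/IH].
  by rewrite Kc.2; apply: anc_refl.
by rewrite (last_cutE Wx xr); case: ifP.
Qed.

Lemma last_cut_mono x y : W y -> anc x y -> anc (last_cut x) (last_cut y).
Proof.
move=> Wy xy; have Wx := anc_verts PT Wy xy.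
apply: last_cut_max => //; first exact: last_cut_cuts.
exact: anc_trans (last_cut_anc Wx) xy.
Qed.

Definition cut_parent t := last_cut (P t).

Lemma cut_parent_height t : W t -> t <> r -> h (cut_parent t) < h t.
Proof.
move=> Wt tr; apply: leq_ltn_trans (pt_height PT Wt tr).
have WPt := pt_verts PT Wt.
exact: anc_height PT _ _ WPt (last_cut_anc WPt).
Qed.

(** Had [t] failed the test in [last_cut], then [last_cut t] would be [cut_parent t], which is lower
    than [t]. *)
Lemma bd_above_cut_parent t a : cuts t -> t <> r -> bd t a -> anc (cut_parent t) a.
Proof.
move=> [Wt lt] tr Ba; move: lt; rewrite last_cutE //; case: asboolP => [H _|_ E].
  exact: H.
by have := cut_parent_height Wt tr; rewrite /cut_parent E ltnn.
Qed.

Lemma cut_tree_exists : exists2 D, parent_tree D r cut_parent h & verts D = cuts.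
Proof.
apply: parent_tree_exists.
- by split; [apply: pt_root PT|apply: last_cut_root].
- by rewrite /cut_parent (pt_parent_root PT) last_cut_root.
- by move=> x [Wx _]; apply: last_cut_cuts; apply: pt_verts PT _ Wx.
- by move=> x [Wx _]; apply: cut_parent_height.
Qed.

(** For a vertex of [G] this is, by [up_comp_owner], the greatest cut vertex whose [up_comp]
    contains [v]. *)
Definition owner v := last_cut (f v).

Definition bag s := [set v | (verts G v /\ owner v = s) \/ interval s v].

Lemma owner_cuts v : verts G v -> cuts (owner v).
Proof. by move=> Gv; apply: last_cut_cuts; apply: foot_verts FM _ Gv. Qed.

Lemma up_comp_owner t v : cuts t ->
  (up_comp t v <-> verts G v /\ anc t (owner v)).
Proof.
move=> Kt; split=> -[Gv tv]; have Wfv := foot_verts FM Gv; split=> //.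
  exact: last_cut_max.
exact: anc_trans tv (last_cut_anc Wfv).
Qed.

(** The interval lies between [cut_parent t] and [P t], and no further cut vertex occurs there.
    Hence intervals with a common vertex belong to cut vertices with the same cut parent. *)
Lemma interval_owner t v : cuts t -> interval t v -> owner v = cut_parent t.
Proof.
move=> Kt Iv; have [Wv tr _ _] := interval_verts Kt.1 Iv.
case: Iv => vt [a Ba av]; have WPt := pt_verts PT Kt.1.
rewrite /owner (foot_id FM Wv); apply: (anc_antisym PT).
- exact: (last_cut_cuts WPt).1.
- exact: last_cut_mono.
- apply: last_cut_max => //; first exact: last_cut_cuts.
  exact: anc_trans (bd_above_cut_parent Kt tr Ba) av.
Qed.

Lemma bag_sub s : cuts s -> bag s `<=` verts G.
Proof. by move=> [Ws _] v [[]//|/(interval_verts Ws)[/TG.1]]. Qed.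

(** * The cut tree as an upwards disjoint tree-decomposition *)

Section CutTree.
Variable D : graph V.
Hypotheses (PD : parent_tree D r cut_parent h) (ED : verts D = cuts).

Local Notation tanc := (ancestor cut_parent).

(** Descending through cut parents skips no cut vertex, as [cut_parent y] is the greatest one
    strictly below [y]; so the order of [D] is induced by that of [T]. *)
Lemma tanc_anc x y : cuts y -> (tanc x y <-> cuts x /\ anc x y).
Proof.
move=> Ky; split=> [xy|[Kx xy]].
  have Kx : cuts x by rewrite -ED; apply: (anc_verts PD) xy; rewrite ED.
  split=> //; case: xy => n; elim: n x {Kx} => [|n IH] x /= <-; first exact: anc_refl.
  have Kn : cuts (iter n cut_parent y).
    by rewrite -ED; apply: (anc_verts PD (y := y)); [rewrite ED|exists n].
  apply: anc_trans (IH _ (erefl _)); apply: anc_trans (anc_parent P _).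
  by apply: last_cut_anc; apply: pt_verts PT _ Kn.1.
have Dy : verts D y by rewrite ED.
move: y Dy {Ky} xy; apply: (parent_ind PD) => [/(anc_root_eq PT) ->|y Dy yr IH xy].
  exact: anc_refl.
case: (pselect (x = y)) => [->|nxy]; first exact: anc_refl.
apply: anc_trans (anc_parent _ y); apply: IH; apply: last_cut_max => //.
  by apply: pt_verts PT _ _; move: Dy; rewrite ED => -[].
exact: anc_strict.
Qed.

Lemma cut_parent_cuts t : cuts t -> cuts (cut_parent t).
Proof. by move=> [Wt _]; apply: last_cut_cuts; apply: pt_verts PT _ Wt. Qed.

Lemma cut_parent_not_above t : cuts t -> t <> r -> ~ tanc t (cut_parent t).
Proof. by move=> Kt tr /(anc_strict_neq PD); rewrite ED; apply. Qed.

Lemma cut_tree_adj t1 t2 : adj D t1 t2 -> exists u, [/\ cuts u, u <> r &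
  t1 = cut_parent u /\ t2 = u \/ t1 = u /\ t2 = cut_parent u].
Proof.
case/(pt_adj PD); rewrite ED => K1 K2 [[nr <-]|[nr <-]].
  by exists t1; split=> //; right.
by exists t2; split=> //; left.
Qed.

Lemma bag_owner_cases s v : cuts s -> bag s v -> s = owner v \/
  [/\ s <> r, cut_parent s = owner v & interval s v].
Proof.
move=> Ks [[_ ->]|Iv]; [by left|right; split=> //].
  by have [] := interval_verts Ks.1 Iv.
by rewrite (interval_owner Ks Iv).
Qed.

Lemma interval_bag_parent t : cuts t -> interval t `<=` bag (cut_parent t).
Proof.
move=> Kt v Iv; left; split; last exact: interval_owner.
by have [/TG.1] := interval_verts Kt.1 Iv.
Qed.

(** A vertex of both bags outside the interval would be owned by [t], but the vertices in the bag of
    [cut_parent t] have owners lower than [t]. *)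
Lemma separator_bag t : cuts t -> t <> r -> separator bag (cut_parent t) t = interval t.
Proof.
move=> Kt tr; have lt := cut_parent_height Kt.1 tr.
apply/seteqP; split=> [v [Pv tv]|v Iv]; last first.
  by split; [apply: interval_bag_parent|right].
case: (bag_owner_cases Kt tv) => [E|[]//].
case: (bag_owner_cases (cut_parent_cuts Kt) Pv) => [E'|[nr E' _]].
  by rewrite E' -E ltnn in lt.
have := cut_parent_height (cut_parent_cuts Kt).1 nr.
by rewrite E' -E ltnNge ltnW.
Qed.

(* The nodes whose bags contain [v] form a star with centre [owner v]. *)
Lemma bag_above_child v s d : cuts s -> bag s v -> tanc d s ->
  tanc (owner v) d -> d <> owner v -> s = d.
Proof.
move=> Ks sv ds vd dv; apply: contrapT => sd.
have Ds : verts D s by rewrite ED.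
have lt := anc_height_lt PD (anc_verts PD Ds ds) vd (nesym dv).
have := anc_height_lt PD Ds ds (nesym sd).
case: (bag_owner_cases Ks sv) => [->|[sr E _]]; first by rewrite ltnNge ltnW.
have := anc_height PD _ (anc_strict ds (nesym sd)).
rewrite ED => /(_ (cut_parent_cuts Ks)).
by rewrite E leqNgt lt.
Qed.

Lemma bag_above_owner v s : cuts s -> bag s v -> tanc (owner v) s.
Proof.
move=> Ks /(bag_owner_cases Ks)[->|[_ <- _]]; first exact: anc_refl.
exact: anc_parent.
Qed.

(** Adjacent vertices have comparable owners. If these differ, the vertex with the lower owner is a
    neighbour of [up_comp] of the upper owner, so it lies in the interval there and both ends share
    that bag. *)
Lemma cut_tree_decomposition : tree_decomposition G D bag.
Proof.
split.
- exact: parent_tree_tree PD.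
- apply/seteqP; split=> [v [t]|v Gv]; first by rewrite ED => /bag_sub; apply.
  by exists (owner v); [rewrite ED; apply: owner_cuts|left].
- move=> x y; wlog xy : x y / tanc (owner x) (owner y) => [W xy|].
    have Gx := adj_verts xy; have Gy := adj_vertsr xy.
    have Wx := foot_verts FM Gx; have Wy := foot_verts FM Gy.
    case: (foot_adj FM xy) => a.
      apply: W => //; apply/tanc_anc; first exact: owner_cuts.
      by split; [apply: owner_cuts|apply: last_cut_mono].
    have [||t [? ? ?]] := W y x; last by exists t.
      apply/tanc_anc; first exact: owner_cuts.
      by split; [apply: owner_cuts|apply: last_cut_mono].
    by rewrite adj_sym.
  move=> a; have Gx := adj_verts a; have Gy := adj_vertsr a.
  have Ky := owner_cuts Gy; have Kx := owner_cuts Gx.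
  exists (owner y); split; [by rewrite ED| |by left].
  case: (pselect (owner x = owner y)) => [E|nE]; first by left.
  right; apply: ((up_comp_boundary Ky.1).2 y x).
  + by rewrite adj_sym.
  + by apply/up_comp_owner => //; split=> //; apply: anc_refl.
  + move/(up_comp_owner x Ky) => [_ yx]; apply: nE.
    by apply: (anc_antisym PT Ky.1) => //; have [] := (tanc_anc (owner x) Ky).1 xy.
- move=> t1 p t2 tp t2p v [v1 v2].
  have K t : t \in t1 :: p -> cuts t by rewrite -ED; apply: gpath_verts tp.
  have K1 := K _ (mem_head _ _); have K2 := K _ (mem_last _ _); have Kt2 := K _ t2p.
  have Dt2 : verts D t2 by rewrite ED.
  have Gv := bag_sub K1 v1.
  have c2 : tanc (owner v) t2.
    apply: ((subtree_convex PD tp t2p _).2 (bag_above_owner K1 v1)).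
    by split=> _; apply: bag_above_owner.
  (* Let [d] be the child of the centre [owner v] at or below [t2]. By convexity an end of the path
     lies above [d], hence is [d] itself. If [t2] were not [d], an end would also lie above some
     child [d'] of [d], where no bag contains [v]. *)
  case: (pselect (owner v = t2)) => [<-|nv2]; first by left.
  have [d [Ed dv d2]] := anc_child c2 nv2.
  have vd : tanc (owner v) d by rewrite -Ed; apply: anc_parent.
  have bagd : bag d v /\ (t1 = d \/ last t1 p = d).
    case: (pselect (tanc d t1)) => [d1|nd1].
      by have E := bag_above_child K1 v1 d1 vd dv; rewrite -{1}E; split=> //; left.
    case: (pselect (tanc d (last t1 p))) => [dl|ndl].
      by have E := bag_above_child K2 v2 dl vd dv; rewrite -{1}E; split=> //; right.
    by case: (nd1); apply: ((subtree_convex PD tp t2p _).1 d2); split.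
  case: (pselect (d = t2)) => [<-|nd2]; first by case: bagd.
  have [d' [Ed' dd' d'2]] := anc_child d2 nd2; exfalso.
  have Dd' := anc_verts PD Dt2 d'2.
  have dd'' : tanc d d' by rewrite -Ed'; apply: anc_parent.
  have d'v : d' <> owner v.
    move=> E; have := anc_antisym PD Dd' dd''; rewrite E => /(_ vd) Edv.
    by apply: dv.
  have vd' := anc_trans vd dd''.
  have out s : cuts s -> bag s v -> tanc d' s -> s = d'.
    by move=> Ks sv d's; apply: bag_above_child sv d's vd' d'v.
  have out' s : cuts s -> bag s v -> ~ tanc d' s.
    move=> Ks sv d's; apply: dd'; rewrite -(out _ Ks sv d's).
    by apply: bag_above_child sv (anc_trans dd'' d's) vd dv.
  have n1 := out' _ K1 v1; have n2 := out' _ K2 v2.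
  by apply: (n1); apply: ((subtree_convex PD tp t2p _).1 d'2); split.
Qed.

(** Let [w] and [u] be the upper ends of the two edges. A common vertex of their intervals gives
    them the same cut parent, which must then be the last vertex of the path. But a path from [r] to
    [cut_parent w] cannot contain [w]. *)
Lemma cut_tree_upwards_disjoint : upwards_disjoint D r bag.
Proof.
move=> t1 t2 p [e1 e2] /cut_tree_adj[u [Ku ur Eu]] [rp _ lp] ep.
have [e12 e1p e2p] := path_edgesP (let: And3 _ pp _ := rp in pp) ep.
have {}e1p : e1 \in r :: p by apply: mem_belast.
have {}e2p : e2 \in r :: p by rewrite inE e2p orbT.
have [w [Kw wr Ew]] := cut_tree_adj e12.
rewrite /=; apply/seteqP; split=> // v [ev tv]; exfalso.
have Iw : interval w v.
  rewrite -(separator_bag Kw wr); case: Ew ev => -[-> ->] //.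
  by rewrite separator_sym.
have Iu : interval u v.
  rewrite -(separator_bag Ku ur); case: Eu tv => -[-> ->] //.
  by rewrite separator_sym.
have Ewu : cut_parent w = cut_parent u.
  by rewrite -(interval_owner Kw Iw) -(interval_owner Ku Iu).
have [wp Pwp] : w \in r :: p /\ cut_parent w \in r :: p by case: Ew => -[<- <-].
have Pl : cut_parent w = last r p.
  apply: (lp _ Pwp).1; rewrite Ewu; case: Eu => -[-> ->]; by [left|right].
have := subtree_convex PD (u := w) rp wp; rewrite -Pl.
have nr : ~ tanc w r by move/(anc_root_eq PD).
have nP := cut_parent_not_above Kw wr.
have E : tanc w r <-> tanc w (cut_parent w) by split.
by move=> /(_ E)[/(_ (anc_refl _ _))].
Qed.

Lemma interval_finite t : W t -> finite_set (interval t).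
Proof. by move=> /up_comp_boundary[]. Qed.

(** The parent [P t] is a neighbour of [up_comp t], so it belongs to the interval, and descending in
    [T] from it reaches every other vertex within the interval. *)
Lemma interval_connected t : W t -> t <> r -> connected (induced G (interval t)).
Proof.
move=> Wt tr; have WPt := pt_verts PT Wt; have GPt := TG.1 _ WPt.
have IPt : interval t (P t).
  split; first exact: anc_refl.
  exists (P t); last exact: anc_refl.
  split=> //; split.
    by move=> [_]; rewrite (foot_id FM WPt) => /(anc_strict_neq PT Wt tr).
  exists t; first exact: up_comp_self.
  by apply: TG.2; apply: (parent_adj PT).
have top x : interval t x -> component (induced G (interval t)) (P t) x.
  move=> [xt [a Ba ax]]; apply: (component_anc PT) => // z xz zt; split=> //.
  by exists a => //; apply: anc_trans ax xz.
split; first by exists (P t).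
move=> x y [_ Ix] [_ Iy]; apply: component_trans (top _ Iy).
by apply: component_sym; apply: top.
Qed.

(** * How the ends of [G] orient the edges of the cut tree *)

Lemma bags_above u : cuts u -> u <> r ->
  (\bigcup_(t in side D (cut_parent u) u) bag t) `\` separator bag (cut_parent u) u
    = up_comp u.
Proof.
move=> Ku ur; have Du : verts D u by rewrite ED.
rewrite (separator_bag Ku ur) (side_down PD Du ur) ED; apply/seteqP; split=> v.
  move=> [[t [Kt ut] tv] nIv]; have Gv := bag_sub Kt tv.
  apply/(up_comp_owner _ Ku); split=> //; have Kv := owner_cuts Gv.
  suff uv : tanc u (owner v) by have [] := (tanc_anc u Kv).1 uv.
  case: (bag_owner_cases Kt tv) => [<-//|[tr <- Itv]].
  case: (pselect (u = t)) => [E|/(anc_strict ut)//].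
  by case: nIv; rewrite E.
move=> Cv; have [Gv uv] := (up_comp_owner v Ku).1 Cv; have Kv := owner_cuts Gv.
split; first by exists (owner v); [split=> //; apply/tanc_anc|left].
by move/(interval_verts Ku.1) => [Wv _ _]; apply; move: Cv.2; rewrite (foot_id FM Wv).
Qed.

Lemma bags_below u : cuts u -> u <> r ->
  (\bigcup_(t in side D u (cut_parent u)) bag t) `\` separator bag u (cut_parent u)
    = verts G `&` (~` up_comp u `\` interval u).
Proof.
move=> Ku ur; have Du : verts D u by rewrite ED.
rewrite separator_sym (separator_bag Ku ur) (side_up PD Du ur) ED.
apply/seteqP; split=> v.
  move=> [[t [Kt ut] tv] nIv]; have Gv := bag_sub Kt tv; have Kv := owner_cuts Gv.
  split=> //; split=> // /(up_comp_owner v Ku)[_ uv]; apply: ut.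
  apply: (@anc_trans _ _ (owner v)); first exact/tanc_anc.
  exact: bag_above_owner.
move=> [Gv [nCv nIv]]; split=> //; have Kv := owner_cuts Gv.
exists (owner v); last by left.
split=> // /(tanc_anc _ Kv)[_ uv]; apply: nCv; exact/up_comp_owner.
Qed.

(** For an end this is a down-closed chain of [D] containing [r]: if bounded, its top is the node
    where [w] lives, and otherwise it describes the end of [D] to which [w] corresponds. *)
Definition end_cuts w := [set t | cuts t /\ forall R, w R -> has_tail_in R (up_comp t)].

Lemma orients_down w u : cuts u -> u <> r ->
  (orients D bag w (cut_parent u) u <-> end_cuts w u).
Proof. by move=> Ku ur; rewrite /orients bags_above //; split=> [|[]]. Qed.

Lemma orients_up w u : is_end G w -> cuts u -> u <> r ->
  (orients D bag w u (cut_parent u) <-> ~ end_cuts w u).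
Proof.
move=> ew Ku ur; rewrite /orients bags_below //; split=> [H [_ C]|nC].
  have [R wR] := end_nonempty ew.
  by have [n [? [_ []]]] := tail_in_exists (tail_in_cap (C _ wR) (H _ wR)).
case: (end_dichotomy ew (up_comp_boundary Ku.1)) => [C|H R wR]; first by case: nC.
apply: tail_in_cap (H _ wR); exists 0 => n _.
exact: ray_verts (end_ray ew wR).
Qed.

Lemma points_toP w (z : V + set (nat -> V)) : is_end G w -> node_or_end D z ->
  (forall u, cuts u -> u <> r -> (end_cuts w u <-> on_side D (cut_parent u) u z)) ->
  (forall u, cuts u -> u <> r -> (~ end_cuts w u <-> on_side D u (cut_parent u) z)) ->
  points_to D bag w z.
Proof.
move=> ew Dz down up; split=> // t1 t2 /cut_tree_adj[u [Ku ur [[-> ->]|[-> ->]]]].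
  by apply: iff_trans (down _ Ku ur); apply: orients_down.
by apply: iff_trans (up _ Ku ur); apply: orients_up.
Qed.

Lemma end_cuts_chain w : is_end G w -> chain cut_parent (end_cuts w).
Proof.
move=> ew x y [Kx wx] [Ky wy]; have [R wR] := end_nonempty ew.
have [n [[_ xn] [_ yn]]] := tail_in_exists (tail_in_cap (wx _ wR) (wy _ wR)).
by case: (anc_chain xn yn) => a; [left|right]; apply/tanc_anc.
Qed.

Lemma end_cuts_down w : down_closed cut_parent (end_cuts w).
Proof.
move=> x y [Ky wy] /(tanc_anc _ Ky)[Kx xy]; split=> // R /wy.
exact: tail_in_sub (up_comp_sub xy).
Qed.

Lemma end_cuts_root w : is_end G w -> end_cuts w r.
Proof.
move=> ew; split; first by rewrite -ED; apply: pt_root PD.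
move=> R wR; exists 0 => n _; apply: up_comp_root.
exact: ray_verts (end_ray ew wR).
Qed.

Lemma end_cuts_sub w : end_cuts w `<=` verts D.
Proof. by move=> u [Ku _]; rewrite ED. Qed.

Lemma points_to_node w t : is_end G w -> end_cuts w t ->
  (forall u, end_cuts w u -> tanc u t) -> points_to D bag w (inl t).
Proof.
move=> ew wt tmax; have Dt := end_cuts_sub wt.
have Kt := wt.1.
have E u : end_cuts w u <-> tanc u t.
  by split=> [/tmax//|]; apply: end_cuts_down.
apply: points_toP => // u Ku ur; rewrite /on_side ?(side_down PD) ?(side_up PD) ?ED //.
  by split=> [/E|[_ /E]].
by split=> [nu|[_ nu] /E //]; split=> // /E.
Qed.

(** Meant for unbounded [end_cuts w], where the inclusion already forces equality of the two
    chains. *)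
Definition tree_end w := [set Q | ray D Q /\ end_cuts w `<=` ray_chain D cut_parent Q].

Lemma tree_end_chain w Q : unbounded h (end_cuts w) -> tree_end w Q ->
  ray_chain D cut_parent Q = end_cuts w.
Proof.
move=> uw [rQ wQ]; apply/seteqP; split=> // u.
by apply: (ray_chain_sub PD uw wQ); apply: end_cuts_down.
Qed.

Lemma tree_end_is_end w : is_end G w -> unbounded h (end_cuts w) -> is_end D (tree_end w).
Proof.
move=> ew uw.
have [R rR tR] := chain_ray PD (@end_cuts_sub w) (end_cuts_chain ew) (@end_cuts_down w) uw.
have wR : end_cuts w `<=` ray_chain D cut_parent R.
  move=> u wu; split; first exact: end_cuts_sub wu.
  by apply: tail_in_sub (tR _ wu) => t [/end_cuts_sub].
exists R => //; apply/seteqP; split=> Q [rQ].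
  by move=> wQ; split=> //; apply: ray_chain_equiv PD _ _ _ uw wR wQ.
by move=> RQ; split=> //; rewrite -(ray_equiv_chain PD rR rQ RQ).
Qed.

Lemma points_to_end w : is_end G w -> unbounded h (end_cuts w) ->
  points_to D bag w (inr (tree_end w)).
Proof.
move=> ew uw; have ee := tree_end_is_end ew uw.
have [Q0 eQ0] := end_nonempty ee.
apply: points_toP => // u Ku ur; rewrite /on_side ?(side_down PD) ?(side_up PD) ?ED //.
  split=> [wu Q [_ /(_ _ wu)[_]]|]; first by rewrite ED.
  move=> /(_ _ eQ0) tu; rewrite -(tree_end_chain uw eQ0); split; rewrite ED //.
have bdu := subtree_boundary PD u.
split=> [nu Q eQ|/(_ _ eQ0) tu wu]; last first.
  have [_ tu'] := eQ0.2 _ wu.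
  by have [n [[_ ?] [_ ?]]] := tail_in_exists (tail_in_cap tu tu').
case: (tail_dichotomy eQ.1 bdu) => [tu|[n0 tu]].
  by case: nu; rewrite -(tree_end_chain uw eQ); split=> //; rewrite ED.
have KQ n : cuts (Q n) by rewrite -ED; apply: ray_verts eQ.1.
exists n0 => n /tu[nun _]; split=> // un; apply: nun; split=> //.
by rewrite ED.
Qed.

Lemma ray_equiv_of_cuts L R Q : unbounded h L -> L `<=` cuts ->
  (forall t, L t -> has_tail_in R (up_comp t)) ->
  (forall t, L t -> has_tail_in Q (up_comp t)) -> ray_equiv G R Q.
Proof.
move=> uL LK LR LQ; apply: ray_equiv_of_common => X /up_comp_finite[M Mt].
have [t Lt lt] := uL M.+1.
exists (up_comp t); split; [exact: LR|exact: LQ|exact: Mt|].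
by move=> x y; apply: up_comp_connected; apply: (LK _ Lt).1.
Qed.

Lemma end_cuts_inj w w' : is_end G w -> is_end G w' -> unbounded h (end_cuts w) ->
  end_cuts w = end_cuts w' -> w = w'.
Proof.
suff H (v v' : set (nat -> V)) : is_end G v -> is_end G v' -> unbounded h (end_cuts v) ->
    end_cuts v = end_cuts v' -> v `<=` v'.
  move=> ew ew' uw E; apply/seteqP; split; first exact: H.
  by apply: H => //; rewrite -E.
move=> ev ev' uv E Q vQ; have rQ := end_ray ev vQ.
have [R rR Ev'] := ev'.
have v'R : v' R by rewrite Ev'; split=> //; apply: ray_equiv_refl.
rewrite Ev'; split=> //.
apply: (ray_equiv_of_cuts uv) => [t []//|t|t [_]]; last exact.
by rewrite E => -[_]; apply.
Qed.

(** The chain [L] of cut vertices along a ray of [eta] has as its down-closure in [T] an unbounded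
    chain [L']. A ray of [T] along [L'] is a ray of [G], and [w] is its end. *)
Lemma tree_end_surj eta : is_end D eta -> exists w,
  [/\ is_end G w, unbounded h (end_cuts w) & tree_end w = eta].
Proof.
move=> eeta; have [Q0 rQ0 Eeta] := eeta.
pose L := ray_chain D cut_parent Q0.
have uL : unbounded h L := ray_chain_unbounded PD rQ0.
have LK : L `<=` cuts by move=> u []; rewrite ED.
pose L' := [set x | exists2 u, L u & anc x u].
have L'W : L' `<=` W by move=> x [u /LK[Wu _] xu]; apply: anc_verts PT _ _ Wu xu.
have L'c : chain P L'.
  move=> x y [u Lu xu] [v Lv yv].
  case: (ray_chain_chain Lu Lv) => /tanc_anc.
    case/(_ (LK _ Lv)) => _ uv; exact: anc_chain (anc_trans xu uv) yv.
  case/(_ (LK _ Lu)) => _ vu; exact: anc_chain xu (anc_trans yv vu).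
have L'd : down_closed P L'.
  by move=> x y [u Lu yu] xy; exists u => //; apply: anc_trans xy yu.
have LL' : L `<=` L' by move=> u Lu; exists u => //; apply: anc_refl.
have uL' : unbounded h L' by move=> n; have [u /LL' ? ?] := uL n; exists u.
have [R [Rinj Radj] tR] := chain_ray PT L'W L'c L'd uL'.
have rR : ray G R by split=> // n; apply: TG.2.
have LR u : L u -> has_tail_in R (up_comp u).
  move=> Lu; apply: tail_in_sub (tR _ (LL' _ Lu)) => x [/L'W Wx ux].
  by split; [apply: TG.1|rewrite (foot_id FM Wx)].
pose w := [set Q | ray G Q /\ ray_equiv G R Q].
have ew : is_end G w by exists R.
have Lw : L `<=` end_cuts w.
  move=> u Lu; split; first exact: LK.
  move=> Q [rQ RQ]; apply: ray_equiv_tail rQ (up_comp_boundary _) RQ (LR _ Lu).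
  exact: (LK _ Lu).1.
have uw : unbounded h (end_cuts w) by move=> n; have [u /Lw ? ?] := uL n; exists u.
have Ew : end_cuts w = L.
  apply/seteqP; split=> // u wu; have [t Lt ut] := uL (h u).+1.
  apply: (ray_chain_down PD Lt).
  by apply: (anc_of_height PD (end_cuts_chain ew) wu (Lw _ Lt) _ ut); apply: end_cuts_sub wu.
exists w; split=> //; rewrite Eeta; apply/seteqP; split=> Q [rQ].
  by rewrite Ew => LQ; split=> //; apply: ray_chain_equiv PD _ _ _ uL _ LQ.
by move=> Q0Q; split=> //; rewrite Ew /L (ray_equiv_chain PD rQ0 rQ Q0Q).
Qed.

(** * Unbounded chains of cuts versus undominated ends in the closure *)

Lemma unbounded_undominated w : is_end G w -> unbounded h (end_cuts w) -> undominated G w.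
Proof.
move=> ew uw R wR v [p [pAB pdis]]; have rR := end_ray ew wR.
have [M Mv] := up_comp_finite (finite_set1 v).
(* The height of [t] keeps [v] out of [up_comp t]. The cut vertex [t1] strictly below [t] makes
   [cut_parent t] higher than [owner v], so [v] is not in [interval t] either. *)
have [t1 wt1 ht1] := uw (maxn M (h (owner v))).+1.
have [t wt ht] := uw (h t1).+1.
have Kt := wt.1; have Dt := end_cuts_sub wt.
have t1t : tanc t1 t.
  exact: (anc_of_height PD (end_cuts_chain ew) wt1 wt (end_cuts_sub wt1) ht).
have nCv : ~ up_comp t v.
  move/(Mv t); apply=> //; apply: leq_ltn_trans ht; apply: leq_trans (ltnW ht1).
  exact: leq_maxl.
have nIv : ~ interval t v.
  move=> /(interval_owner Kt) E.
  have : tanc t1 (cut_parent t).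
    by apply: anc_strict => // E1; rewrite E1 ltnn in ht.
  move/(anc_height PD); rewrite ED -E => H.
  have Kv : cuts (owner v) by rewrite E; apply: cut_parent_cuts.
  by have := leq_trans ht1 (H Kv); rewrite ltnNge leq_maxr.
have [n0 tR] := wt.2 _ wR.
have bdt := up_comp_boundary Kt.1.
pose X := interval t `|` R @` `I_n0.
have finX : finite_set X.
  by rewrite finite_setU; split; [apply: bdt.1|apply: finite_image].
(* Without [v] the paths of the fan are disjoint, so one of them avoids [X]. It ends on the tail of
   [R] in [up_comp t] and would have to cross [interval t]. *)
have [n nX] : exists n, forall z, z \in [seq a <- v :: p n | a != v] -> ~ X z.
  apply: (disjoint_avoids_finite (L := fun n => [seq a <- v :: p n | a != v])) => // m n z.
  rewrite !mem_filter.
  move=> /andP[/eqP zv zm] /andP[_ zn]; apply: contrapT => nmn.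
  by apply: zv; apply: pdis nmn zm zn.
have {}nX z : z \in v :: p n -> z <> v -> ~ X z.
  by move=> zp /eqP zv; apply: nX; rewrite mem_filter zp andbT.
have [[Gv vp _] _ lB] := pAB n.
have lp := mem_last v (p n).
have [[i _ Ei] lv] := (lB _ lp).2 (erefl _).
have nXl := nX _ lp lv.
have Cl : up_comp t (last v (p n)).
  rewrite -Ei; apply: tR; rewrite leqNgt; apply/negP=> ni.
  by apply: nXl; right; exists i.
have [|a [b [ab Ca Cb ap _]]] := @path_cross _ _ (~` up_comp t) _ _ vp nCv; first exact.
have Ia : interval t a.
  by apply: (bdt.2 b a) => //; [rewrite adj_sym|apply: contrapT].
by apply: (nX a ap); [move=> E; apply: nIv; rewrite -E|left].
Qed.

(** After any index [N] the ray still has to enter [up_comp t] for some high cut vertex [t], and it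
    enters through [interval t], a subset of the normal tree. These vertices are the teeth of a comb
    with trivial paths. *)
Lemma unbounded_in_closure w : is_end G w -> unbounded h (end_cuts w) ->
  in_closure G W w.
Proof.
move=> ew uw; have [R wR] := end_nonempty ew; have rR := end_ray ew wR.
exists R => //; apply: ray_comb => // N.
have [M MN] := up_comp_finite (finite_set1 (R N)).
have [t wt ht] := uw M.+1; have Wt := wt.1.1.
have nC : ~ up_comp t (R N) by move/(MN t ht); apply.
have [m tR] := wt.2 _ wR.
apply: contrapT => nW.
have stay i : N <= i -> ~ up_comp t (R i).
  elim: i => [|i IH]; first by rewrite leqn0 => /eqP <-.
  rewrite leq_eqVlt => /orP[/eqP <-//|Ni] Ci; apply: nW; exists i => //.
  have Ii : interval t (R i).
    apply: ((up_comp_boundary Wt).2 (R i.+1) (R i)) => //; last exact: IH.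
    by rewrite adj_sym; apply: rR.2.
  by have [] := interval_verts Wt Ii.
by apply: (stay (maxn N m)); [apply: leq_maxl|apply: tR; apply: leq_maxr].
Qed.

Definition end_verts w := [set t | W t /\ forall R, w R -> has_tail_in R (up_comp t)].

Lemma end_verts_chain w : is_end G w -> chain P (end_verts w).
Proof.
move=> ew x y [Wx wx] [Wy wy]; have [R wR] := end_nonempty ew.
have [n [[_ xn] [_ yn]]] := tail_in_exists (tail_in_cap (wx _ wR) (wy _ wR)).
exact: anc_chain xn yn.
Qed.

Lemma end_verts_down w : down_closed P (end_verts w).
Proof.
move=> x y [Wy wy] xy; split; first exact: anc_verts PT _ _ Wy xy.
by move=> R /wy; apply: tail_in_sub (up_comp_sub xy).
Qed.

(** The finite set [X] of vertices at or below [t] is avoided by a tail of the spine and by some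
    path of the comb starting on that tail. Both then stay in one set [up_comp y] containing the
    tooth [z], whose neighbours all lie in [X]. *)
Lemma end_verts_unbounded w : is_end G w -> in_closure G W w -> unbounded h (end_verts w).
Proof.
move=> ew [Q wQ [rQ [x [p [pG xQ dis pW]]]]].
apply: unbounded_of_progress => [|t wt].
  by exists r; have [Kr wr] := end_cuts_root ew; split=> //; apply: Kr.1.
pose X := [set y | anc y t].
have finX : finite_set X := finite_anc PT wt.1.
have [n0 QX] := ray_avoids_finite rQ finX.
have [n nZ] : exists n, forall z, z \in x n :: p n -> ~ (X `|` Q @` `I_n0) z.
  apply: (disjoint_avoids_finite (L := fun n => x n :: p n)) => //.
  by rewrite finite_setU; split=> //; apply: finite_image.
have [i _ Ei] := (xQ n _ (mem_head _ _)).2 (erefl _).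
have ni : n0 <= i.
  rewrite leqNgt; apply/negP=> ni; apply: (nZ _ (mem_head _ _)); right.
  by exists i.
pose z := last (x n) (p n); have Wz : W z := pW n.
have nzt : ~ anc z t by move=> zt; apply: (nZ z (mem_last _ _)); left.
(* Descending from [z], [y] is the last vertex that is not at or below [t]. *)
have [y [Wy yz nyt Pyt]] : exists y, [/\ W y, anc y z, ~ anc y t & anc (P y) t].
  move: z Wz nzt; apply: (parent_ind PT) => [[]|z Wz zr IH nzt].
    exact: anc_root PT _ wt.1.
  case: (pselect (anc (P z) t)) => [Pzt|/IH[y [Wy yPz nyt Pyt]]].
    by exists z; split=> //; apply: anc_refl.
  by exists y; split=> //; apply: anc_trans yPz (anc_parent P z).
have bdX : forall a b, adj G a b -> up_comp y a -> ~ up_comp y b -> X b.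
  move=> a b ab Ca Cb; have [b1 _] := (up_comp_boundary Wy).2 _ _ ab Ca Cb.
  exact: anc_trans b1 Pyt.
have Cz : up_comp y z by apply: up_comp_sub yz _ (up_comp_self Wz).
have Cx : up_comp y (x n).
  apply: contrapT => nCx; have [_ px _] := pG n.
  have [|a [b [ab Ca Cb ap _]]] := @path_cross _ _ (~` up_comp y) _ _ px nCx.
    exact.
  apply: (nZ _ ap); left; apply: (bdX b a) => //; first by rewrite adj_sym.
  exact: contrapT.
have wy : end_verts w y.
  split=> //; apply: end_tail ew (up_comp_boundary Wy) wQ _; exists i => j.
  elim: j => [|j IH]; first by rewrite leqn0 => /eqP <-; rewrite Ei.
  rewrite leq_eqVlt => /orP[/eqP <-|ij]; first by rewrite Ei.
  apply: contrapT => nC; apply: (QX j.+1).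
    by apply: leq_trans ni _; apply: ltnW.
  exact: bdX (rQ.2 j) (IH ij) nC.
exists y => //; case: (end_verts_chain ew wt wy) => // ty.
by apply: anc_height_lt PT _ _ Wy ty _ => E; apply: nyt; rewrite -E; apply: anc_refl.
Qed.

(** To avoid a given list [l], take [t] so high that [up_comp t] misses [l]. This connected set
    meets [Q] and has [v] as a neighbour. *)
Lemma fan_dominates w v Q s : is_end G w -> w Q -> unbounded h (end_verts w) ->
  (forall t, end_verts w t -> h s < h t -> bd t v) -> dominates G v Q.
Proof.
move=> ew wQ uw Bv; apply: dominates_of_fan => l.
have finl : finite_set [set` l] by apply/finite_seqP; exists l.
have [M Ml] := up_comp_finite finl.
have [t wt ht] := uw (maxn M (h s)).+1.
have [Gv [nCv [u Cu uv]]] : bd t v.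
  by apply: Bv => //; apply: leq_ltn_trans ht; apply: leq_maxr.
have [j Cj] := tail_in_exists (wt.2 _ wQ).
have [||x [p [xp pU]]] := @AB_path_in _ G ([set v] `|` up_comp t) [set v]
    (range Q `\ v) v (Q j) (erefl _).
- by split; [exists j|move=> E; apply: nCv; rewrite -E].
- apply: (@component_trans _ _ u).
    apply: component_adj; apply/adj_induced; rewrite adj_sym; split=> //; first by left.
    by right.
  apply: component_sub (up_comp_connected wt.1 Cu Cj).
    by split; [apply: Cu.1|right].
  by move=> a b /adj_induced[ab Ca Cb]; apply/adj_induced; split=> //; right.
have xv : x = v by have [_ /(_ x (mem_head _ _))[_ /(_ (erefl _))]] := xp.
rewrite {}xv in xp pU; exists p => // z /pU[//|Cz] zl.
exfalso; apply: (Ml t) Cz zl; apply: leq_ltn_trans ht; exact: leq_maxl.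
Qed.

Lemma undominated_unbounded w : is_end G w -> undominated G w -> in_closure G W w ->
  unbounded h (end_cuts w).
Proof.
move=> ew nd cw; apply: contrapT => nuw.
have [s ws smax] := bounded_has_max PD (@end_cuts_sub w) (end_cuts_chain ew)
  (ex_intro _ r (end_cuts_root ew)) nuw.
have uw := end_verts_unbounded ew cw.
have [Q wQ] := end_nonempty ew.
have vs : end_verts w s by split; [apply: ws.1.1|apply: ws.2].
have above t : end_verts w t -> h s < h t -> anc s t /\ s <> t.
  move=> wt st; split; last by move=> E; rewrite E ltnn in st.
  exact: (anc_of_height PT (end_verts_chain ew) vs wt vs.1 st).
(* The last cut vertex strictly below [t] is [s]. If every neighbour were at or above [s], then [t]
   would pass the test and be a cut vertex beyond the maximum [s]. *)
have low t : end_verts w t -> h s < h t -> exists2 a, bd t a & anc a s.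
  move=> wt st; have [ast nst] := above _ wt st; have Wt := wt.1.
  apply: contrapT => nex.
  have sB a : bd t a -> anc s a.
    move=> Ba; have [_ _ aPt] := bd_strict Wt Ba.
    case: (anc_chain (anc_strict ast nst) aPt) => // as_.
    by case: nex; exists a.
  have tr : t <> r by move=> E; move: ast; rewrite E => /(anc_root_eq PT) E'; apply: nst; rewrite E.
  have WPt := pt_verts PT Wt.
  have ls : tanc (last_cut (P t)) s.
    apply: smax; split; first exact: last_cut_cuts.
    have lt : anc (last_cut (P t)) t.
      exact: anc_trans (last_cut_anc WPt) (anc_parent P t).
    by have [] := end_verts_down wt lt.
  have sl : anc s (last_cut (P t)).
    by apply: last_cut_max => //; [apply: ws.1|apply: anc_strict].
  have E : last_cut (P t) = s.
    by apply: (anc_antisym PT vs.1) => //; have [] := (tanc_anc (last_cut (P t)) ws.1).1 ls.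
  have Kt : cuts t.
    by split=> //; rewrite last_cutE // E; case: asboolP.
  have ts : tanc t s by apply: smax; split=> //; apply: wt.2.
  have := anc_height PD (end_cuts_sub ws) ts; by rewrite leqNgt st.
(* Passing down from [t] to [t'] enlarges [up_comp], but a vertex [a] at or below [s] stays
   outside. *)
have mono t t' a : end_verts w t -> end_verts w t' -> h s < h t' -> h t' <= h t ->
    anc a s -> bd t a -> bd t' a.
  move=> wt wt' st' tt' as_ [Ga [nCa [u Cu ua]]].
  have [st's nst'] := above _ wt' st'.
  have Wa := anc_verts PT vs.1 as_.
  have at' : anc t' t.
    move: tt'; rewrite leq_eqVlt => /orP[/eqP E|]; last first.
      exact: (anc_of_height PT (end_verts_chain ew) wt' wt wt'.1).
    case: (end_verts_chain ew wt' wt) => // tt'.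
    case: (pselect (t = t')) => [->|nE]; first exact: anc_refl.
    by have := anc_height_lt PT wt'.1 tt' nE; rewrite E ltnn.
  split=> //; split; last by exists u => //; apply: up_comp_sub at' _ Cu.
  move=> [_]; rewrite (foot_id FM Wa) => t'a.
  by have := anc_height PT vs.1 (anc_trans t'a as_); rewrite leqNgt st'.
(* Otherwise each of the finitely many [a] at or below [s] fails at some [F a]. A vertex [t] higher
   than all [F a] has some such [a] as a neighbour, which by [mono] does not fail at [F a]. *)
have [v vs' Bv] : exists2 v, anc v s & forall t, end_verts w t -> h s < h t -> bd t v.
  apply: contrapT => nv.
  have /choice[F FP] a : exists t, anc a s -> [/\ end_verts w t, h s < h t & ~ bd t a].
    case: (pselect (anc a s)) => [as_|]; last by exists a.
    apply: contrapT => nt; apply: nv; exists a => // t wt st.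
    by apply: contrapT => nB; apply: nt; exists t.
  have /finite_seqP[l El] := finite_anc PT vs.1.
  have [M lM] := seq_bounded_height h (map F l).
  have [t wt ht] := uw (maxn M (h s)).+1.
  have st : h s < h t by apply: leq_ltn_trans ht; apply: leq_maxr.
  have [a Ba as_] := low _ wt st; have [wF sF nF] := FP _ as_.
  have al : a \in l by have : [set y | anc y s] a by []; rewrite El.
  apply: nF; apply: (mono _ _ _ wt wF sF _ as_ Ba).
  apply: leq_trans (ltnW ht); apply: leq_trans (lM _ (map_f F al)) _.
  exact: leq_maxl.
exact: nd wQ _ (fan_dominates ew wQ uw Bv).
Qed.

(** * Displaying the ends, and the final assembly *)

Lemma cut_tree_displays : displays G D bag
  [set w | [/\ is_end G w, undominated G w & in_closure G W w]].
Proof.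
have /choice[tau tauP] w : exists z : V + set (nat -> V), is_end G w ->
    points_to D bag w z /\
    if pselect (unbounded h (end_cuts w)) then z = inr (tree_end w)
    else exists2 t, verts D t & z = inl t.
  (* The value [inl r] is a dummy for sets [w] that are not ends. *)
  case: (pselect (is_end G w)) => [ew|]; last by exists (inl r).
  case: (pselect (unbounded h (end_cuts w))) => uw /=.
    by exists (inr (tree_end w)) => _; split=> //; apply: points_to_end.
  have [t wt tmax] := bounded_has_max PD (@end_cuts_sub w) (end_cuts_chain ew)
    (ex_intro _ r (end_cuts_root ew)) uw.
  exists (inl t) => _; split; first exact: points_to_node.
  by exists t => //; apply: end_cuts_sub wt.
have tauE w : is_end G w -> unbounded h (end_cuts w) -> tau w = inr (tree_end w).
  by move=> ew uw; have [_] := tauP w ew; case: pselect.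
exists tau; split.
- by move=> w /tauP[].
- split.
  + move=> w [ew nd cw]; have uw := undominated_unbounded ew nd cw.
    by rewrite tauE //; exists (tree_end w) => //; apply: tree_end_is_end.
  + move=> w w' /set_mem[ew nd cw] /set_mem[ew' nd' cw'].
    have uw := undominated_unbounded ew nd cw.
    have uw' := undominated_unbounded ew' nd' cw'.
    rewrite !tauE // => -[E]; apply: end_cuts_inj => //.
    have [Q wQ] := end_nonempty (tree_end_is_end ew uw).
    rewrite -(tree_end_chain uw wQ); apply: tree_end_chain => //.
    by rewrite -E.
  + move=> _ [eta eeta <-]; have [w [ew uw <-]] := tree_end_surj eeta.
    exists w; last exact: tauE.
    by split=> //; [apply: unbounded_undominated|apply: unbounded_in_closure].
- move=> w ew nw; have [_] := tauP w ew; case: pselect => //= uw.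
  case: nw; split=> //; [exact: unbounded_undominated|exact: unbounded_in_closure].
Qed.

(** Each node is a vertex of the normal tree that owns itself, so its own bag already meets [W]. *)
Lemma cut_tree_covers : covers_cofinally D r bag W.
Proof.
move=> t Dt; exists t; split=> //.
  have [p rp lp] := (parent_tree_connected PD).2 _ _ (pt_root PD) Dt.
  by exists p; split=> //; rewrite -lp mem_last.
rewrite ED in Dt; exists t; split; last by case: Dt.
by left; split; [apply: TG.1; case: Dt|rewrite /owner (foot_id FM Dt.1); apply: Dt.2].
Qed.

End CutTree.
End Decomposition.

Theorem theorem3p8 (V : choiceType) (G TNT : graph V) (r0 : V)
    (connG : connected G) (normalT : normal_tree G TNT r0)
    (finN : forall x, verts (induced G (~` verts TNT)) x ->
      finite_set (neighbourhood G (component (induced G (~` verts TNT)) x))) :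
  exists (N : choiceType) (T : graph N) (r : N) (part : N -> set V),
    [/\ rooted_tree T r /\ tree_decomposition G T part,
        upwards_disjoint T r part /\
        (forall t1 t2, adj T t1 t2 ->
           finite_set (separator part t1 t2) /\
           connected (induced G (separator part t1 t2))),
        displays G T part
          [set w | [/\ is_end G w, undominated G w
                     & in_closure G (verts TNT) w]] &
        covers_cofinally T r part (verts TNT)].
Proof.
have [TG rT _] := normalT.
have [P [h [PT hS]]] := rooted_tree_parent rT.
have [f FM] := foot_map_exists connG normalT PT finN.
have [D PD ED] := cut_tree_exists G f PT hS.
(* The nodes are cut vertices, so [V] itself serves as the type of nodes. *)
exists V, D, r0, (bag G P f h); split.
- split; first by split; [apply: parent_tree_tree PD|apply: pt_root PD].
  exact: cut_tree_decomposition PD ED.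
- split; first exact: cut_tree_upwards_disjoint PD ED.
  move=> t1 t2 /(cut_tree_adj PD ED)[u [Ku ur Eu]].
  have -> : separator (bag G P f h) t1 t2 = interval G P f u.
    rewrite -(separator_bag TG PT hS FM Ku ur); case: Eu => -[-> ->] //.
    exact: separator_sym.
  by split; [apply: interval_finite PT FM _ Ku.1|apply: interval_connected TG PT FM _ Ku.1 ur].
- exact: cut_tree_displays PD ED.
- exact: cut_tree_covers PD ED.
Qed.
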